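(* Let $\gamma\in C^{2}(0,1]$ be a real-valued function that is monotonic on $(0,1]$ with $\lim_{t\rightarrow 0^+}\gamma(t)=0$. Suppose that: (i) there exist positive constants $C^{(1)}_{1},C^{(2)}_{1}$ such that $\left|\frac{t^{j}\gamma^{(j)}(t)}{\gamma(t)}\right|\geq C^{(j)}_{1}$ for all $t\in(0,1]$ and $j=1,2$; (ii) there exists a positive constant $C^{(1)}_{2}$ such that $\left|\frac{t\gamma'(t)}{\gamma(t)}\right|\leq C^{(1)}_{2}$ for all $t\in(0,1]$. Let $\omega:=\limsup_{t\rightarrow 0^{+}}\frac{\ln|\gamma(t)|}{\ln t}$, let $$\vartriangle:=\left\{\left(\tfrac1p,\tfrac1q\right):\ \tfrac1{2p}\leq\tfrac1q\leq\tfrac1p,\ \tfrac1q\geq\tfrac2p-1\right\},$$ and for $x=(x_1,x_2)\in\mathbb{R}^2$, $u\in[1,2]$ let $Tf(x,u):=\int_0^1 f(x_1-ut,\,x_2-u\gamma(t))\,dt$. For $p,q\in[1,\infty]$ consider the assertion $(\ast)$ there exists a positive constant $C$, independent of $u\in[1,2]$, such that for all $f\in L^p(\mathbb{R}^2)$ and all $u\in[1,2]$, $$\|Tf(\cdot,u)\|_{L^q_x(\mathbb{R}^2)}\leq C\|f\|_{L^p_x(\mathbb{R}^2)}.$$ Then: (1) $(\ast)$ holds if $\left(\frac1p,\frac1q\right)\in\ \vartriangle$ and $1+(1+\omega)\left(\frac1q-\frac1p\right)>0$; (2) $(\ast)$ holds only if $\left(\frac1p,\frac1q\right)\in\ \vartriangle$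 and $1+(1+\omega)\left(\frac1q-\frac1p\right)\geq 0$.
   Context: The quotients in (i) and (ii) presuppose $\gamma(t)\neq 0$ for $t\in(0,1]$. Exponents range over $[1,\infty]$ with the convention $1/\infty=0$. *)

(* Defs.v *)
From HB Require Import structures.
From mathcomp Require Import all_boot all_order all_algebra.
From mathcomp Require Import all_classical all_reals all_analysis.

Set Implicit Arguments.
Unset Strict Implicit.
Unset Printing Implicit Defensive.

Import Order.TTheory GRing.Theory Num.Theory.
Import numFieldNormedType.Exports.

Local Open Scope classical_set_scope.
Local Open Scope ring_scope.

(* Derivatives relative to a set: the difference quotient only uses points of
   D, so that at the endpoint 1 of ]0, 1] the derivative is one-sided. *)
Definition diff_quot {R : realType} (f : R -> R) (t s : R) : R :=
  (f s - f t) / (s - t).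

Definition derivable_in {R : realType} (D : set R) (f : R -> R) : Prop :=
  forall t, D t -> cvg (diff_quot f t s @[s --> within D t^']).

Definition derive_in {R : realType} (D : set R) (f : R -> R) (t : R) : R :=
  lim (diff_quot f t s @[s --> within D t^']).

Definition deriven_in {R : realType} (D : set R) (n : nat) (f : R -> R)
    : R -> R :=
  iter n (derive_in D) f.

Definition Cn_in {R : realType} (D : set R) (n : nat) (f : R -> R) : Prop :=
  (forall j, (j < n)%N -> derivable_in D (deriven_in D j f)) /\
  {within D, continuous (deriven_in D n f)}.

Definition monotonic_in {R : realType} (D : set R) (f : R -> R) : Prop :=
  {in D &, {homo f : s t / s <= t}} \/ {in D &, {homo f : s t /~ s <= t}}.

Definition omega {R : realType} (gamma : R -> R) : \bar R :=
  limf_esup (fun t => (ln `|gamma t| / ln t)%:E) 0^'+.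

Definition triangle {R : realType} : set (R * R) :=
  [set xy | [/\ xy.1 / 2 <= xy.2, xy.2 <= xy.1 & 2 * xy.1 - 1 <= xy.2]].

(* The extended-real inverse is used because it sends +oo to 0. *)
Definition recip {R : realType} (p : \bar R) : R := fine (p^-1)%E.

Definition plane (R : realType) := (measurableTypeR R * measurableTypeR R)%type.

Definition lebesgue2 {R : realType} : {measure set (plane R) -> \bar R} :=
  (@lebesgue_measure R \x @lebesgue_measure R)%E.

(* For f in L^p with 1 <= p the integrand is absolutely integrable for almost
   every x; on the remaining null set of x the value is immaterial. *)
Definition avg {R : realType} (gamma : R -> R) (f : plane R -> R) (u : R)
    (x : plane R) : \bar R :=
  (\int[lebesgue_measure]_(t in `]0%R, 1%R])
     (f ((x.1 - u * t)%R, (x.2 - u * gamma t)%R))%:E)%E.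

Definition uniform_Lp_Lq {R : realType} (gamma : R -> R) (p q : \bar R)
    : Prop :=
  exists2 C : R, 0 < C &
    forall f : plane R -> R, f \in Lfun lebesgue2 p ->
    forall u : R, 1 <= u <= 2 ->
      ('N[lebesgue2]_q[avg gamma f u]
         <= C%:E * 'N[lebesgue2]_p[EFin \o f])%E.

(* Main.v *)
(* Sufficiency. Cut the curve into dyadic pieces t ~ 2^-j. On a piece J of length
   dl, fix x and put F t = f (x - Gamma t), M = int_J F. Since half of M^2 comes
   from the pairs with F s <= F t, one has
     M^q <= 4^q int_J F t (int_(F s <= F t) F s ds)^(q-1) dt.
   Integrate in x, translate so that F t becomes f y, and estimate the inner
   integral by int |t - s| f (y + Gamma t - Gamma s)^p ds; there f is at most
   f y. The integral of this over t is at most k times the p-th power of the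
   norm of f, by the change of variables (t, s) |-> Gamma t - Gamma s, whose
   Jacobian is at least |t - s| / k thanks to the lower bound on gamma''. This
   is a strong type estimate at (1/p, 1/q) with q = p / (2 - p), p <= 3/2, and
   Jensen's inequality gives the rest of the triangle. The resulting constants
   for the pieces are summable when 1 + (1 + omega) (1/q - 1/p) > 0.

   Necessity. Test the inequality on indicator functions: of a large square
   (1/q <= 1/p), of a small ball (1/q >= 2/p - 1), of a neighbourhood of the
   reflected curve (1/q >= 1/(2p)), and of boxes of size t by |gamma t| at the
   origin, along a sequence t -> 0 realizing omega. *)
From HB Require Import structures.
Require Import Defs.
From mathcomp Require Import all_boot all_order all_algebra.
From mathcomp Require Import all_classical all_reals all_analysis.
From mathcomp Require Import measurable_realfun ess_sup_inf.
From mathcomp Require Import ring lra.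
Set Implicit Arguments.
Unset Strict Implicit.
Unset Printing Implicit Defensive.
Import Order.TTheory GRing.Theory Num.Theory.
Import numFieldNormedType.Exports.
Local Open Scope classical_set_scope.
Local Open Scope ring_scope.

(** The whole edge is reached without interpolation: the truncation [F s <= F t] bounds the inner
    function by its value at the outer point, and this is what turns the energy estimate into a
    strong type bound. On the edge write q = 1 + 2 th and q / p = 1 + th; the level then enters
    exactly as its p-th power. The limit p <= 3/2, the vertex (2/3, 1/3), is where th <= 1 and where
    d ^ (2 (p - 1)) <= d for all d > 1. No differentiable change of variables occurs. The
    substitution for (t, s) is split into v = t - s and, for fixed v, the increment of gamma over a
    step v; each is a one-dimensional map that expands distances, and such maps pull measures back
    with a bounded factor. The factor u >= 1 only enlarges the expansion. At scale dl the second
    derivative of gamma is at least of order |gamma| / dl ^ 2, so a piece contributes, to the q-th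
    power, a constant of order dl ^ (q - th) |gamma| ^ (- th) with th = q / p - 1. If |gamma t| >= c
    t ^ w, this is a power of dl with exponent q (1 + (1 + w) (1/q - 1/p)): hence the condition on
    omega. *)

Ltac meas_step :=
  match goal with
  | |- measurable_fun _ (fun=> _) => exact: measurable_cst
  | H : measurable_fun _ ?f |- measurable_fun _ ?f => exact: H
  | |- measurable_fun _ (fun z => EFin (@?a z)) => apply/measurable_EFinP
  | |- measurable_fun _ (fun z => mule (@?a z) (@?b z)) =>
      apply: (@emeasurable_funM _ _ _ _ a b)
  | |- measurable_fun _ (fun z => GRing.add (@?a z) (@?b z)) =>
      apply: (@emeasurable_funD _ _ _ _ a b)
  | |- measurable_fun _ (fun z => GRing.add (@?a z) (GRing.opp (@?b z))) =>
      apply: (@measurable_funB _ _ _ _ a b)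
  | |- measurable_fun _ (fun z => GRing.add (@?a z) (@?b z)) =>
      apply: (@measurable_funD _ _ _ _ a b)
  | |- measurable_fun _ (fun z => GRing.mul (@?a z) (@?b z)) =>
      apply: (@measurable_funM _ _ _ _ a b)
  | |- measurable_fun _ (fun z => Num.norm (@?a z)) =>
      apply: (measurableT_comp (@normr_measurable _ _) (g := a))
  | |- measurable_fun _ (fun z => powR (@?a z) ?r) =>
      apply: (measurableT_comp (@measurable_powR _ r) (g := a))
  | |- measurable_fun _ (fun z => poweR (@?a z) ?r) =>
      apply: (measurableT_comp (@measurable_poweR _ r) (g := a))
  | |- measurable_fun _ (fun z => (@?a z, @?b z)) =>
      apply: (@measurable_fun_pair _ _ _ _ _ _ a b)
  | |- measurable_fun _ (fun z => (@?a z <= @?b z)) =>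
      apply: (@measurable_fun_ler _ _ _ _ a b)
  | |- measurable_fun _ (fun z => fst (@?a z)) =>
      apply: (measurableT_comp measurable_fst (g := a))
  | |- measurable_fun _ (fun z => snd (@?a z)) =>
      apply: (measurableT_comp measurable_snd (g := a))
  | |- measurable_fun _ fst => exact: measurable_fst
  | |- measurable_fun _ snd => exact: measurable_snd
  | |- measurable_fun _ (fun z => z) => exact: measurable_id
  | H : measurable_fun _ ?f |- measurable_fun _ (fun z => ?f (@?a z)) =>
      apply: (measurableT_comp H (g := a))
  | _ => apply: measurable_fun_ifT
  end.

Ltac meas := repeat meas_step.

(** * Expansive maps and Lebesgue measure *)

Lemma powRS (R : realType) (a p : R) : 0 < a -> a `^ p = a * a `^ (p - 1).
Proof.
move=> a0; rewrite -{2}(powRr1 (ltW a0)) -powRD ?(gt_eqF a0) ?implybT//.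
by rewrite addrC subrK.
Qed.

Lemma le_lebesgue_diameter (R : realType) (E : set R) (d : R) :
  measurable E -> 0 <= d -> (forall x y, E x -> E y -> `|x - y| <= d) ->
  (lebesgue_measure E <= d%:E)%E.
Proof.
move=> mE d0 Ed; have [->|/set0P[x0 Ex0]] := eqVneq E set0.
  by rewrite measure0 lee_fin.
have lbE : has_lbound E.
  exists (x0 - d) => x Ex; have := Ed _ _ Ex0 Ex.
  by rewrite ler_norml => /andP[_]; lra.
have supE x : E x -> x <= inf E + d.
  move=> Ex; rewrite -lerBlDr; apply: lb_le_inf; first by exists x0.
  by move=> y Ey; have := Ed _ _ Ex Ey; rewrite ler_norml => /andP[_]; lra.
have subE : E `<=` `[inf E, inf E + d]%classic.
  by move=> x Ex /=; rewrite in_itv/= supE// andbT; exact: ge_inf.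
apply: (@le_trans _ _ (lebesgue_measure `[inf E, inf E + d]%classic)).
  by apply: le_measure => //; rewrite inE//; exact: measurable_itv.
rewrite lebesgue_measure_itv/= lte_fin.
by case: ifP => _; rewrite -?EFinB lee_fin//; lra.
Qed.

Definition expansive_on (R : realType) (J : set R) (c : R) (phi : R -> R) :=
  forall s t, J s -> J t -> c * `|s - t| <= `|phi s - phi t|.

(** Pull back a cover of [A] by half-open intervals: the part of [J] sent into an interval of length
    d has diameter at most d / c, hence measure at most d / c. The infimum over covers is the outer
    measure of [A]. *)
Lemma expansive_preimage (R : realType) (J : set R) (c : R) (phi : R -> R)
    (A : set R) :
  measurable J -> 0 < c -> measurable_fun setT phi -> expansive_on J c phi ->
  measurable A ->
  (lebesgue_measure (phi @^-1` A `&` J) <= c^-1%:E * lebesgue_measure A)%E.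
Proof.
move=> mJ c0 mphi Jphi mA.
have mpre (B : set R) : measurable B -> measurable (phi @^-1` B `&` J).
  move=> mB; apply: measurableI => //.
  by rewrite -[_ @^-1` _]setTI; exact: mphi.
rewrite lee_pdivlMl//.
rewrite {2}/lebesgue_measure /lebesgue_stieltjes_measure /measure_extension.
apply: le_ereal_inf_tmp => _ [F [mF AF] <-].
have mFR k : measurable (F k : set R) by exact: sub_sigma_algebra.
rewrite -lee_pdivlMl//.
have sub : phi @^-1` A `&` J `<=` \bigcup_k (phi @^-1` (F k) `&` J).
  by move=> x [/AF[k _ Fk] Jx]; exists k.
apply: (@le_trans _ _ (\sum_(k <oo) lebesgue_measure (phi @^-1` F k `&` J))%E).
  apply: measure_sigma_subadditive => //; first by move=> k; exact: mpre.
  exact: mpre.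
rewrite -nneseriesZl; last by move=> k _; exact: wlength_ge0.
apply: lee_nneseries => // k _.
have /ocitvP[Fk0|[[a b]/= ab ->]] := mF k.
  by rewrite Fk0 preimage_set0 set0I !measure0 mule0.
have -> : wlength idfun `]a, b]%classic = (b - a)%:E.
  by rewrite wlength_itv/= lte_fin ab.
rewrite -EFinM.
apply: le_lebesgue_diameter.
- by apply: mpre; exact: measurable_itv.
- by rewrite mulr_ge0 ?invr_ge0 ?ltW// subr_gt0.
move=> x y /= [+ Jx] [+ Jy]; rewrite !in_itv/= => xab yab.
rewrite ler_pdivlMl//; apply: le_trans (Jphi _ _ Jx Jy) _.
by rewrite ler_norml; apply/andP; split; lra.
Qed.

(** The inequality form of substitution: the image under [phi] of Lebesgue measure on [J] is
    dominated by [c^-1] times Lebesgue measure. *)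
Lemma ge0_integral_expansive (R : realType) (J : set R) (c : R) (phi : R -> R)
    (h : R -> \bar R) :
  measurable J -> 0 < c -> measurable_fun setT phi -> expansive_on J c phi ->
  measurable_fun setT h -> (forall x, 0 <= h x)%E ->
  (\int[lebesgue_measure]_(t in J) h (phi t)
     <= c^-1%:E * \int[lebesgue_measure]_x h x)%E.
Proof.
move=> mJ c0 mphi Jphi mh h0.
pose ci : {nonneg R} := NngNum (ltW (eq_ind_r is_true c0 (invr_gt0 c))).
pose mR := measurableTypeR R.
have mphi' : measurable_fun (setT : set mR) (phi : mR -> mR) := mphi.
have mh' : measurable_fun (setT : set mR) (h : mR -> _) := mh.
pose muJ : {measure set mR -> \bar R} := mrestr (@lebesgue_measure R) (mJ : measurable (J : set mR)).
rewrite (eq_measure_integral muJ); last first.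
  by move=> A mA AJ; rewrite /muJ/= /mrestr setIidl.
apply: (@le_trans _ _ (\int[muJ]_t h (phi t))%E).
  apply: ge0_subset_integral => //; exact: measurableT_comp.
have := @ge0_integral_pushforward _ _ mR mR _ phi mphi' muJ setT h measurableT mh'.
rewrite preimage_setT => <- //.
rewrite -(@ge0_integral_mscale _ mR _ lebesgue_measure setT measurableT ci)//.
apply: ge0_le_measure_integral => // S mS.
exact: expansive_preimage.
Qed.

(** * Powers of an integral and sublevel sets *)

(* Layering: if [M] is the integral of [F], the values of [t] with
   [sublevel_integral m F (F t)] at least [M / 4] carry a fixed part of [M],
   because by symmetry at least half of [M ^ 2] lies on [F s <= F t]. *)
Definition sublevel_integral d (T : measurableType d) (R : realType)
    (m : {measure set T -> \bar R}) (F : T -> R) (a : R) : \bar R :=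
  (\int[m]_s (if F s <= a then F s else 0)%:E)%E.

Lemma sublevel_integral_ge0 d (T : measurableType d) (R : realType)
    (m : {measure set T -> \bar R}) (F : T -> R) (a : R) :
  (forall t, 0 <= F t) -> (0 <= sublevel_integral m F a)%E.
Proof. by move=> F0; apply: integral_ge0 => s _; rewrite lee_fin; case: ifP. Qed.

Lemma measurable_sublevel_integral d (T : measurableType d) (R : realType)
    (m : {sigma_finite_measure set T -> \bar R}) (F : T -> R) :
  measurable_fun setT F -> (forall t, 0 <= F t) ->
  measurable_fun setT (fun t => sublevel_integral m F (F t)).
Proof.
move=> mF F0.
apply: (@measurable_fun_fubini_tonelli_F _ _ T T R m
  (fun z => (if F z.2 <= F z.1 then F z.2 else 0)%:E)).
  meas.
by move=> z; rewrite lee_fin; case: ifPn.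
Qed.

Lemma sqr_integral_le_sublevel d (T : measurableType d) (R : realType)
    (m : {sigma_finite_measure set T -> \bar R}) (F : T -> R) :
  measurable_fun setT F -> (forall t, 0 <= F t) ->
  (\int[m]_t (F t)%:E * \int[m]_t (F t)%:E
    <= 2%:E * \int[m]_t ((F t)%:E * sublevel_integral m F (F t)))%E.
Proof.
move=> mF F0.
pose k a b := if b <= a then b else 0 : R.
have k0 s t : 0 <= k (F s) (F t) by rewrite /k; case: ifPn.
have mI : measurable_fun setT (fun z : T * T => (F z.1 * k (F z.1) (F z.2))%:E).
  by rewrite /k; meas.
have I0 z : (0 <= (F z.1 * k (F z.1) (F z.2))%:E)%E by rewrite lee_fin mulr_ge0.
have mI2 : measurable_fun setT (fun z : T * T => (F z.2 * k (F z.2) (F z.1))%:E).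
  by rewrite /k; meas.
have I20 z : (0 <= (F z.2 * k (F z.2) (F z.1))%:E)%E by rewrite lee_fin mulr_ge0.
have F0e t : (0 <= (F t)%:E)%E by rewrite lee_fin.
have mFe : measurable_fun setT (fun t => (F t)%:E) by meas.
have mk t : measurable_fun setT (fun s => (k (F t) (F s))%:E) by rewrite /k; meas.
have E1 : (\int[m]_t ((F t)%:E * sublevel_integral m F (F t)) =
           \int[m]_t \int[m]_s (F t * k (F t) (F s))%:E)%E.
  apply: eq_integral => t _; apply/esym.
  apply: (@ge0_integralZl _ T R m setT measurableT
    (fun s => (k (F t) (F s))%:E) (mk t) (F t)%:E) => //.
  by move=> s _; rewrite lee_fin.
rewrite {1}E1 -ge0_integralZr//; last exact: integral_ge0.
rewrite [X in (X <= _)%E](_ : _ = \int[m]_t \int[m]_s (F t * F s)%:E)%E; last first.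
  by apply: eq_integral => t _; rewrite -ge0_integralZl.
rewrite -[(2%:E)%E]/((1 + 1)%:E)%E EFinD ge0_muleDl// mul1e.
rewrite [X in (_ <= _ + X)%E](fubini_tonelli _ mI I0) -ge0_integralD//; last 4 first.
- by move=> t _; apply: integral_ge0 => s _; exact: (I0 (t, s)).
- exact: (measurable_fun_fubini_tonelli_F _ mI I0).
- by move=> t _; apply: integral_ge0 => s _; exact: (I0 (s, t)).
- exact: (measurable_fun_fubini_tonelli_G _ mI I0).
have mFF : measurable_fun setT (fun z : T * T => (F z.1 * F z.2)%:E) by meas.
have FF0 z : (0 <= (F z.1 * F z.2)%:E)%E by rewrite lee_fin mulr_ge0.
apply: ge0_le_integral => //.
- by move=> t _; apply: integral_ge0 => s _; exact: (FF0 (t, s)).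
- exact: (measurable_fun_fubini_tonelli_F _ mFF FF0).
- apply: emeasurable_funD.
    exact: (measurable_fun_fubini_tonelli_F _ mI I0).
  exact: (measurable_fun_fubini_tonelli_G _ mI I0).
move=> t _; rewrite -ge0_integralD//; last 3 first.
- by move=> s _; exact: (I0 (t, s)).
- by rewrite /k; meas.
- by rewrite /k; meas.
apply: ge0_le_integral => //.
- by move=> s _; exact: (FF0 (t, s)).
- by meas.
- by rewrite /k; meas.
(* For each pair one of the two orderings holds; ties are counted twice, which the inequality
   allows. *)
move=> s _; rewrite -EFinD lee_fin /k.
have [st|/ltW ts] := leP (F s) (F t).
  by rewrite lerDl; case: ifPn => _; rewrite ?mulr0// mulr_ge0.
by rewrite ts mulr0 add0r mulrC.
Qed.

(** Where the sublevel integral is at most M / 4, it contributes at most half of M ^ 2 to the bound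
    of [sqr_integral_le_sublevel] and is absorbed on the left, which requires M to be finite.
    Elsewhere it is bounded by a multiple of its own power q - 1. *)
Lemma le_integral_sublevel_power_fin d (T : measurableType d) (R : realType)
    (m : {sigma_finite_measure set T -> \bar R}) (F : T -> R) (q : R) :
  measurable_fun setT F -> (forall t, 0 <= F t) -> 1 <= q ->
  (\int[m]_t (F t)%:E < +oo)%E ->
  ((\int[m]_t (F t)%:E) `^ q <=
   (4 `^ q)%:E *
     \int[m]_t ((F t)%:E * sublevel_integral m F (F t) `^ (q - 1)))%E.
Proof.
move=> mF F0 q1 Mfin.
have M0 : (0 <= \int[m]_t (F t)%:E)%E by apply: integral_ge0 => t _; rewrite lee_fin.
have mG := measurable_sublevel_integral m mF F0.
have mFe : measurable_fun setT (fun t => (F t)%:E) by meas.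
set X := (\int[m]_t (_ * _ `^ _))%E.
have X0 : (0 <= X)%E.
  by apply: integral_ge0 => t _; rewrite mule_ge0 ?lee_fin ?poweR_ge0.
have sq := sqr_integral_le_sublevel m mF F0.
have GM t : (sublevel_integral m F (F t) <= \int[m]_t (F t)%:E)%E.
  apply: ge0_le_integral => //; try by meas.
    by move=> s _; rewrite lee_fin; case: ifP.
  by move=> s _; rewrite lee_fin; case: ifP.
have [M ME] : exists M, (\int[m]_t (F t)%:E)%E = M%:E.
  by exists (fine (\int[m]_t (F t)%:E)); rewrite fineK// ge0_fin_numE.
rewrite ME in M0 Mfin sq GM *; rewrite lee_fin in M0.
have [->|MN0] := eqVneq M 0.
  by rewrite poweR0r ?gt_eqF ?(lt_le_trans _ q1)// mule_ge0// lee_fin powR_ge0.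
have Mgt0 : 0 < M by rewrite lt_neqAle eq_sym MN0.
(* With this [c], c a ^ (q - 1) = M (4 a / M) ^ (q - 1), which is at least M as soon as a >= M /
   4. *)
pose c := M * (4 / M) `^ (q - 1).
have c0 : 0 <= c by rewrite mulr_ge0// powR_ge0.
have Gle t : (sublevel_integral m F (F t) <=
    (M / 4)%:E + c%:E * sublevel_integral m F (F t) `^ (q - 1))%E.
  have := GM t; have := sublevel_integral_ge0 m (F t) F0.
  case: (sublevel_integral m F (F t)) => [a||]//.
  rewrite !lee_fin => a0 aM.
  have [aM4|/ltW aM4] := leP a (M / 4).
    by rewrite (le_trans aM4)// lerDl mulr_ge0// powR_ge0.
  rewrite (le_trans aM)// (@le_trans _ _ (c * a `^ (q - 1)))//; last first.
    by rewrite lerDr divr_ge0.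
  rewrite /c -mulrA -powRM ?divr_ge0//.
  have e1 : 1 `^ (q - 1) = 1 :> R by rewrite powR1.
  rewrite -[leLHS]mulr1 ler_wpM2l// -[leLHS]e1 ge0_ler_powR ?nnegrE//.
  - by rewrite subr_ge0.
  - by rewrite mulr_ge0 ?divr_ge0.
  - by rewrite mulrAC ler_pdivlMr// mul1r mulrC -ler_pdivrMr.
have {}sq : (M%:E * M%:E <= 2%:E * ((M / 4)%:E * M%:E + c%:E * X))%E.
  apply: le_trans sq _; rewrite lee_wpmul2l//.
  have mX : measurable_fun setT
      (fun t => (F t)%:E * sublevel_integral m F (F t) `^ (q - 1))%E by meas.
  have X0' t : (0 <= (F t)%:E * sublevel_integral m F (F t) `^ (q - 1))%E.
    by rewrite mule_ge0 ?lee_fin ?poweR_ge0.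
  rewrite -(ge0_integralZl m measurableT mX)// -ME.
  have M40 : (0 <= (M / 4)%:E)%E by rewrite lee_fin divr_ge0.
  have F0e t : setT t -> (0 <= (F t)%:E)%E by rewrite lee_fin.
  rewrite -(ge0_integralZl m measurableT mFe F0e M40).
  rewrite -ge0_integralD//; last 4 first.
  - by move=> t _; rewrite mule_ge0// F0e.
  - by meas.
  - by move=> t _; rewrite mule_ge0.
  - by meas.
  apply: ge0_le_integral => //.
  - by move=> t _; apply: mule_ge0; [rewrite lee_fin|exact: sublevel_integral_ge0].
  - by meas.
  - by meas.
  move=> t _; rewrite muleCA [X in (X + _)%E]muleC -ge0_muleDr; last 2 first.
  - by rewrite lee_fin divr_ge0.
  - by rewrite mule_ge0// poweR_ge0.
  by apply: lee_wpmul2l; rewrite ?lee_fin.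
move: X0 sq; case: (X) => [x||]//; last first.
  by move=> _ _; rewrite gt0_muley ?leey// ?lte_fin ?powR_gt0.
rewrite !lee_fin => x0 {}sq.
have Mq : 0 < M `^ (q - 1) by rewrite powR_gt0.
rewrite !(powRS q)//.
have {}sq : M * (M / 4) <= c * x by nra.
move: sq; rewrite /c powRM ?invr_ge0// -(powR_inv1 M0) -powRrM mulN1r powRN.
rewrite -[X in _ <= X]mulrA.
rewrite ler_pM2l// => {}sq.
have := ler_wpM2r (ltW Mq) sq.
by rewrite mulrAC (mulrAC _ _ x) divfK ?gt_eqF//; lra.
Qed.

Lemma le_poweR (R : realType) (x y : \bar R) (r : R) :
  0 <= r -> (0 <= x)%E -> (x <= y)%E -> (x `^ r <= y `^ r)%E.
Proof.
move=> r0 x0 xy; apply: gt0_ler_poweR => //; rewrite in_itv/= ?x0 ?leey//.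
by rewrite (le_trans x0 xy).
Qed.

Lemma poweRK (R : realType) (x : \bar R) (r : R) :
  r != 0 -> (0 <= x)%E -> ((x `^ r) `^ r^-1 = x)%E.
Proof. by move=> r0 x0; rewrite -poweRrM divff// poweRe1. Qed.

(** Finiteness of the integral is removed by truncating [F] at height n: on a finite measure space
    the truncations are integrable, their sublevel integrals do not exceed those of [F] where they
    matter, and monotone convergence concludes. *)
Lemma le_integral_sublevel_power d (T : measurableType d) (R : realType)
    (m : {finite_measure set T -> \bar R}) (F : T -> R) (q : R) :
  measurable_fun setT F -> (forall t, 0 <= F t) -> 1 <= q ->
  ((\int[m]_t (F t)%:E) `^ q <=
   (4 `^ q)%:E *
     \int[m]_t ((F t)%:E * sublevel_integral m F (F t) `^ (q - 1)))%E.
Proof.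
move=> mF F0 q1; have q0 : 0 < q by exact: lt_le_trans q1.
pose Fn (n : nat) t := if F t <= n%:R then F t else 0.
have mFn n : measurable_fun setT (Fn n) by rewrite /Fn; meas.
have Fn0 n t : 0 <= Fn n t by rewrite /Fn; case: ifP.
have FnF n t : Fn n t <= F t by rewrite /Fn; case: ifP.
set Y := ((4 `^ q)%:E * _)%E.
have mG := measurable_sublevel_integral m mF F0.
have Fn_fin n : (\int[m]_t (Fn n t)%:E < +oo)%E.
  apply: (@le_lt_trans _ _ (n%:R%:E * m setT)%E).
    rewrite -(integral_cst m measurableT).
    apply: ge0_le_integral => //; try by meas.
      by move=> t _; rewrite lee_fin.
    by move=> t _; rewrite lee_fin /Fn; case: ifPn.
  by rewrite ltey_eq fin_numM// fin_num_measure.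
(* Taking q-th roots lets the limit in n be taken on the integrals themselves. *)
have FnY n : (\int[m]_t (Fn n t)%:E <= Y `^ q^-1)%E.
  rewrite -[leLHS](@poweRK _ _ q) ?gt_eqF//; last first.
    by apply: integral_ge0 => t _; rewrite lee_fin.
  apply: le_poweR; rewrite ?invr_ge0 ?poweR_ge0 ?(ltW q0)//.
  apply: le_trans (le_integral_sublevel_power_fin (mFn n) (Fn0 n) q1 (Fn_fin n)) _.
  have mGn := measurable_sublevel_integral m (mFn n) (Fn0 n).
  apply: lee_wpmul2l; first by rewrite lee_fin powR_ge0.
  apply: ge0_le_integral => //; try by meas.
    by move=> t _; apply: mule_ge0; rewrite ?lee_fin ?poweR_ge0.
  move=> t _; rewrite {1}/Fn; case: ifP => [Ftn|_]; last first.
    by rewrite mul0e mule_ge0 ?lee_fin ?poweR_ge0.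
  apply: lee_wpmul2l; rewrite ?lee_fin//.
  apply: le_poweR; rewrite ?subr_ge0 ?sublevel_integral_ge0//.
  rewrite {2}/Fn Ftn; apply: ge0_le_integral => //; try by rewrite ?/Fn; meas.
    by move=> s _; rewrite lee_fin; case: ifP.
  move=> s _; rewrite lee_fin /Fn.
  have [_|_] := ifP (F s <= n%:R); first by [].
  by case: ifP => _; case: ifP.
rewrite -[leRHS](@poweRK _ _ q^-1) ?invrK ?gt_eqF ?invr_gt0//; last first.
  rewrite mule_ge0 ?lee_fin ?powR_ge0//.
  by apply: integral_ge0 => t _; rewrite mule_ge0 ?lee_fin ?poweR_ge0.
apply: le_poweR; rewrite ?(ltW q0)//.
  by apply: integral_ge0 => t _; rewrite lee_fin.
have cvgF : ((\int[m]_t (Fn n t)%:E) @[n --> \oo] --> \int[m]_t (F t)%:E)%E.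
  have -> : (\int[m]_t (F t)%:E = \int[m]_t (limn (fun n => (Fn n t)%:E)))%E.
    apply: eq_integral => t _; apply/esym/cvg_lim => //.
    apply: cvg_near_cst; exists (Num.bound (F t)) => // n /= tn.
    rewrite /Fn; case: ifPn => //; rewrite -ltNge => nF; exfalso.
    have := archi_boundP (F0 t); rewrite ltNge => /negP; apply.
    by rewrite (le_trans _ (ltW nF))// ler_nat.
  apply: cvg_monotone_convergence => //.
  - by move=> n; meas.
  - by move=> n t _; rewrite lee_fin.
  - move=> t _ n k nk; rewrite lee_fin /Fn.
    have [Fn1|_] := ifP; last by case: ifP.
    by rewrite (le_trans Fn1)// ler_nat.
rewrite -(cvg_lim _ cvgF)//; apply: lime_le; first by apply/cvg_ex; eexists; exact: cvgF.
exact: nearW.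
Qed.

(** * A Cauchy kernel estimate with weight |t - s| *)

(** On each side of [t] the map s -> e (s - t) / r, with e = 1 or -1, expands by 1 / r and lands in
    the half-line of nonnegative numbers, where the kernel has integral pi / 2. *)
Lemma integral_oneDsqr_scaled (R : realType) (r t : R) : 0 < r ->
  (\int[lebesgue_measure]_s ((oneDsqr ((s - t) / r))^-1)%:E <= (pi * r)%:E)%E.
Proof.
move=> r0; pose mR := measurableTypeR R.
pose h (x : mR) : \bar R := if 0 <= x then ((oneDsqr x)^-1)%:E else 0%E.
have mV : measurable_fun setT (fun x : mR => (oneDsqr x)^-1).
  by apply: continuous_measurable_fun; exact: continuous_oneDsqrV.
have h0 x : (0 <= h x)%E.
  by rewrite /h; case: ifP => // _; rewrite lee_fin invr_ge0 (le_trans _ (oneDsqr_ge1 _)).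
have mh : measurable_fun setT h.
  rewrite /h; apply: measurable_fun_ifT; last 2 first.
  - by apply/measurable_EFinP; exact: mV.
  - exact: measurable_cst.
  apply: (@measurable_fun_ler _ _ _ _ (fun=> 0) (fun x : mR => x)).
    exact: measurable_cst.
  exact: measurable_id.
have Ih : (\int[lebesgue_measure]_x h x = (pi / 2)%:E)%E.
  rewrite -integral0y_oneDsqr [RHS]integral_mkcond; apply: eq_integral => x _.
  by rewrite /h patchE mem_setE in_itv/= andbT.
have half (J : set mR) (e : R) : measurable J -> `|e| = 1 ->
    (forall s, J s -> 0 <= e * (s - t) / r) ->
    (\int[lebesgue_measure]_(s in J) ((oneDsqr ((s - t) / r))^-1)%:E
      <= (pi / 2 * r)%:E)%E.
  move=> mJ e1 Je.
  have -> : (\int[lebesgue_measure]_(s in J) ((oneDsqr ((s - t) / r))^-1)%:E =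
             \int[lebesgue_measure]_(s in J) h (e * (s - t) / r)%R)%E.
    apply: eq_integral => s; rewrite inE => Js; rewrite /h Je// /oneDsqr.
    by rewrite -mulrA [X in _ = _ (1 + X)^-1]exprMn -(real_normK (num_real e)) e1 expr1n mul1r.
  apply: (@le_trans _ _ ((r^-1)^-1%:E * \int[lebesgue_measure]_x h x)%E).
    apply: (@ge0_integral_expansive _ _ _ (fun s => e * (s - t) / r)) => //.
    - by rewrite invr_gt0.
    - by meas.
    - move=> a b Ja Jb; rewrite -mulrBl -mulrBr !normrM e1 mul1r.
      by rewrite opprB addrA subrK (gtr0_norm (_ : 0 < r^-1)) ?invr_gt0// mulrC.
  by rewrite invrK Ih -EFinM mulrC.
pose A : set mR := `]-oo, t]%classic; pose B : set mR := `]t, +oo[%classic.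
have AB : setT = A `|` B.
  apply/seteqP; split=> // s _; have [st|st] := leP s t; [left|right];
  by rewrite /A/B/= in_itv/= ?st.
have mscaled : measurable_fun setT (fun s : mR => ((oneDsqr ((s - t) / r))^-1)%:E).
  apply/measurable_EFinP.
  have := @measurableT_comp _ _ _ mR mR R (fun x => (oneDsqr x)^-1) setT
    (fun s : mR => (s - t) / r).
  by apply => //; meas.
have AB0 : [disjoint A & B].
  apply/disj_setPLR => s /=; rewrite /A/B/= !in_itv/= => st; rewrite andbT.
  by apply/negP; rewrite -leNgt.
rewrite AB ge0_integral_setU//; try exact: measurable_itv; last first.
  exact: measurable_funTS mscaled.
have -> : pi * r = pi / 2 * r + pi / 2 * r by lra.
rewrite EFinD leeD//.
- apply: (half _ (-1)); [exact: measurable_itv|by rewrite normrN1|].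
  move=> s; rewrite /A/= in_itv/= => st; rewrite divr_ge0 ?(ltW r0)//; lra.
- apply: (half _ 1); [exact: measurable_itv|by rewrite normr1|].
  move=> s; rewrite /B/= in_itv/= andbT => st; rewrite divr_ge0 ?(ltW r0)//; lra.
Qed.

(* With [d = `|t - s| / r] the first term is integrable in [s], with integral of
   order [l * r]; [r] is chosen afterwards to balance the two terms. *)
Lemma le_cauchy_kernel_weighted (R : realType) (a l d p : R) :
  0 <= a <= l -> 0 < l -> 0 <= d -> 1 <= p <= 3 / 2 ->
  a <= 2 * l * (1 + d ^+ 2)^-1 + l `^ (1 - p) * (d * a `^ p).
Proof.
move=> /andP[a0 al] l0 d0 /andP[p1 p32].
have D0 : 0 < 1 + d ^+ 2 by rewrite ltr_pwDl ?sqr_ge0.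
have T0 : 0 <= l `^ (1 - p) * (d * a `^ p) by rewrite !mulr_ge0 ?powR_ge0.
have [d1|d1] := leP d 1.
  apply: le_trans al _; rewrite -[leLHS]addr0 lerD// ler_pdivlMr//.
  have : d ^+ 2 <= 1 by rewrite expr_le1.
  by nra.
have d2 : 0 < d ^+ 2 by rewrite exprn_gt0// (lt_trans _ d1).
have [ad|ad] := leP (a * d ^+ 2) l.
  rewrite -[leLHS]addr0 lerD// ler_pdivlMr//.
  have : 1 <= d ^+ 2 by rewrite expr_ge1// ltW.
  by nra.
have apos : 0 < a by rewrite -(pmulr_lgt0 _ d2) (lt_trans l0).
rewrite -[leLHS]add0r lerD//; first by rewrite !mulr_ge0 ?invr_ge0 ?ltW.
rewrite (powRS p apos) -opprB powRN.
rewrite [leRHS]mulrC ler_pdivlMr ?powR_gt0// mulrCA ler_pM2l//.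
(* In this last case d ^ 2 exceeds l / a, so (l / a) ^ (p - 1) <= d ^ (2 (p - 1)), and this is at
   most d because d > 1 and 2 (p - 1) <= 1: the origin of the bound 3 / 2. *)
have dinv : l `^ (p - 1) <= (a * d ^+ 2) `^ (p - 1).
  by rewrite ge0_ler_powR ?nnegrE ?subr_ge0 ?(ltW l0) ?(ltW ad)// mulr_ge0 ?sqr_ge0.
apply: (le_trans dinv); rewrite powRM ?sqr_ge0// mulrC ler_wpM2r ?powR_ge0//.
rewrite -powR_mulrn// -powRrM.
rewrite -[leRHS]powRr1// ler_powR ?(ltW d1)//.
by lra.
Qed.

(** Integrating the pointwise bound gives 2 pi l r + l ^ (1 - p) A / r for every r > 0, where A is
    the weighted integral; optimizing r yields the square root of A. The ceiling [l] on [F] is what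
    the sublevel truncation supplies later. *)
Lemma integral_le_weighted (R : realType)
    (m : {finite_measure set (measurableTypeR R) -> \bar R}) (F : R -> R)
    (l p t : R) :
  (forall A, measurable A -> m A <= lebesgue_measure A)%E ->
  measurable_fun setT F -> (forall s, 0 <= F s <= l) -> 0 < l ->
  1 <= p <= 3 / 2 ->
  (\int[m]_s (F s)%:E <= ((2 * pi + 1) * l `^ (1 - p / 2))%:E *
     (\int[m]_s (`|t - s| * F s `^ p)%:E) `^ (2^-1))%E.
Proof.
move=> mL mF F0l l0 p12; pose mR := measurableTypeR R.
have mF' : measurable_fun (setT : set mR) F := mF.
set A := (\int[m]_s (`|t - s| * _)%:E)%E.
have A0 : (0 <= A)%E.
  by apply: integral_ge0 => s _; rewrite lee_fin mulr_ge0 ?powR_ge0.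
have split r : 0 < r ->
    (\int[m]_s (F s)%:E <= (2 * pi * (l * r))%:E + (l `^ (1 - p) / r)%:E * A)%E.
  move=> r0; pose f1 (s : mR) := ((oneDsqr ((s - t) / r))^-1)%:E.
  have mf1 : measurable_fun setT f1.
    apply/measurable_EFinP.
    have := @measurableT_comp _ _ _ mR mR R (fun x => (oneDsqr x)^-1) setT
      (fun s : mR => (s - t) / r).
    apply => //; last by meas.
    by apply: continuous_measurable_fun; exact: continuous_oneDsqrV.
  have f10 s : (0 <= f1 s)%E.
    by rewrite lee_fin invr_ge0 (le_trans _ (oneDsqr_ge1 _)).
  pose f2 (s : mR) := (`|t - s| * F s `^ p)%:E.
  have mf2 : measurable_fun setT f2 by rewrite /f2; meas.
  have f20 s : (0 <= f2 s)%E by rewrite lee_fin mulr_ge0 ?powR_ge0.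
  apply: (@le_trans _ _ (\int[m]_s ((2 * l)%:E * f1 s + (l `^ (1 - p) / r)%:E * f2 s))%E).
    apply: ge0_le_integral => //.
    - by move=> s _; rewrite lee_fin; have /andP[] := F0l s.
    - by meas.
    - by meas.
    move=> s _; rewrite -!EFinM -EFinD lee_fin.
    have d0 : 0 <= `|t - s| / r by rewrite divr_ge0 ?(ltW r0).
    have := le_cauchy_kernel_weighted (F0l s) l0 d0 p12.
    rewrite /oneDsqr !exprMn real_normK ?num_real// (_ : (t - s) ^+ 2 = (s - t) ^+ 2); last by ring.
    rewrite (_ : l `^ (1 - p) * (_ * _) = l `^ (1 - p) / r * (`|t - s| * F s `^ p))//.
    ring.
  rewrite ge0_integralD//; last 4 first.
  - by move=> s _; rewrite mule_ge0// lee_fin mulr_ge0 ?ltW.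
  - by meas.
  - by move=> s _; rewrite mule_ge0// lee_fin divr_ge0 ?powR_ge0 ?ltW.
  - by meas.
  rewrite !ge0_integralZl//; last 2 first.
  - by rewrite lee_fin divr_ge0 ?powR_ge0 ?ltW.
  - by rewrite lee_fin mulr_ge0 ?ltW.
  apply: leeD => //.
  have -> : (2 * pi * (l * r))%:E = ((2 * l)%:E * (pi * r)%:E)%E.
    by rewrite -EFinM; congr (_%:E); ring.
  rewrite lee_wpmul2l ?lee_fin ?mulr_ge0 ?(ltW l0)//.
  apply: le_trans (integral_oneDsqr_scaled t r0).
  exact: ge0_le_measure_integral.
move: A0 split; case: A => [A||]// A0 split; last first.
  by rewrite poweRyr ?gt0_muley ?leey// lte_fin mulr_gt0 ?powR_gt0// ltr_pwDr// mulr_ge0// pi_ge0.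
rewrite lee_fin in A0.
have [A00|Ane] := eqVneq A 0.
  (* There is nothing to balance when A = 0: r is sent to 0, chosen so that the remaining term
     equals [e]. *)
  rewrite A00 poweR0r// mule0; apply/lee_addgt0Pr => e e0.
  have r0 : 0 < e / (2 * pi * l) by rewrite divr_gt0 ?mulr_gt0 ?pi_gt0.
  have := split _ r0; rewrite A00 mule0 adde0 add0e => /le_trans; apply.
  rewrite lee_fin le_eqVlt (_ : 2 * pi * _ = e) ?eqxx//.
  by rewrite mulrA mulrC divfK ?gt_eqF ?mulr_gt0 ?pi_gt0.
have {}A0 : 0 < A by rewrite lt_neqAle eq_sym Ane.
(* The balancing r: both l r and l ^ (1 - p) A / r become l ^ (1 - p / 2) A ^ (1/2). *)
have r0 : 0 < l `^ (- (p / 2)) * A `^ 2^-1 by rewrite mulr_gt0 ?powR_gt0.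
apply: le_trans (split _ r0) _.
rewrite poweR_EFin -EFinM -EFinD -EFinM lee_fin.
have E1 : l * l `^ (- (p / 2)) = l `^ (1 - p / 2).
  by rewrite powRD ?(gt_eqF l0) ?implybT// powRr1 ?ltW.
have E2 : l `^ (1 - p) / (l `^ (- (p / 2)) * A `^ 2^-1) * A =
    l `^ (1 - p / 2) * A `^ 2^-1.
  rewrite invfM mulrA -powRB ?(gt_eqF l0) ?implybT//.
  have -> : 1 - p - - (p / 2) = 1 - p / 2 by lra.
  rewrite -mulrA; congr (_ * _).
  have E3 : A = A `^ 2^-1 * A `^ 2^-1.
    rewrite -powRD ?(gt_eqF A0) ?implybT//.
    by rewrite (_ : 2^-1 + 2^-1 = 1) ?powRr1 ?ltW//; lra.
  by rewrite [X in _^-1 * X]E3 mulKf ?gt_eqF ?powR_gt0.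
rewrite E2 (mulrA l) E1 le_eqVlt; apply/orP; left; apply/eqP; ring.
Qed.

(** * The edge of the triangle *)

Lemma expansive_translation (R : realType) (a : R) (J : set R) :
  expansive_on J 1 (fun x => x - a).
Proof. by move=> s t _ _; rewrite mul1r opprB addrA subrK. Qed.

Lemma ge0_integral_translation_le (R : realType) (a : R)
    (h : measurableTypeR R -> \bar R) :
  measurable_fun setT h -> (forall x, 0 <= h x)%E ->
  (\int[lebesgue_measure]_x h (x - a)%R <= \int[lebesgue_measure]_x h x)%E.
Proof.
move=> mh h0.
have := @ge0_integral_expansive R setT 1 (fun x => x - a) h measurableT ltr01.
rewrite invr1 mul1e; apply => //; last exact: expansive_translation.
by meas.
Qed.

Lemma ge0_integral_translation2_le (R : realType) (a b : R)
    (h : plane R -> \bar R) :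
  measurable_fun setT h -> (forall x, 0 <= h x)%E ->
  (\int[lebesgue_measure \x lebesgue_measure]_x h (x.1 - a, x.2 - b)%R
    <= \int[lebesgue_measure \x lebesgue_measure]_x h x)%E.
Proof.
move=> mh h0; pose mR := measurableTypeR R.
have mhab : measurable_fun setT (fun x : mR * mR => h (x.1 - a, x.2 - b)).
  by meas.
have mha : measurable_fun setT (fun x : mR * mR => h (x.1 - a, x.2)).
  by meas.
rewrite !fubini_tonelli1//.
apply: (@le_trans _ _ (\int[lebesgue_measure]_x \int[lebesgue_measure]_y
    h ((x - a)%R, y))%E).
  apply: ge0_le_integral => //.
  - by move=> x _; apply: integral_ge0.
  - exact: (measurable_fun_fubini_tonelli_F _ mhab).
  - exact: (measurable_fun_fubini_tonelli_F _ mha).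
  move=> x _.
  apply: (@ge0_integral_translation_le _ b (fun y => h (x - a, y))) => //.
  by meas.
apply: (@ge0_integral_translation_le _ a
  (fun x => \int[lebesgue_measure]_y h (x, y))%E).
  exact: (measurable_fun_fubini_tonelli_F _ mh).
by move=> x; exact: integral_ge0.
Qed.

(* Along a curve [(c1, c2)], [`|t - s|] is up to a constant the Jacobian of
   [(t, s) |-> (c1 t - c1 s, c2 t - c2 s)]. *)
Definition energy_bound (R : realType)
    (m : {measure set (measurableTypeR R) -> \bar R}) (c1 c2 : R -> R)
    (k : R) :=
  forall (h : plane R -> \bar R) (y : plane R), measurable_fun setT h ->
  (forall x, 0 <= h x)%E ->
  (\int[m]_t \int[m]_s
      (`|t - s|%:E * h (y.1 + c1 t - c1 s, y.2 + c2 t - c2 s)%R)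
    <= k%:E * \int[lebesgue_measure \x lebesgue_measure]_x h x)%E.

(* Linearizes [A `^ th], so that the integral of [A] suffices; [b] is free and
   is optimized in [strong_type_edge]. *)
Lemma poweR_le_tangent (R : realType) (A : \bar R) (b th : R) :
  (0 <= A)%E -> 0 < b -> 0 <= th <= 1 ->
  (A `^ th <= (b `^ th)%:E + (b `^ (th - 1))%:E * A)%E.
Proof.
move=> + b0 /andP[th0 th1]; case: A => [a||]//; last first.
  by move=> _; rewrite gt0_muley ?lte_fin ?powR_gt0// addey// leey.
rewrite lee_fin => a0; rewrite poweR_EFin -EFinM -EFinD lee_fin.
have [ab|ba] := leP a b.
  by rewrite -[leLHS]addr0 lerD ?mulr_ge0 ?powR_ge0// ge0_ler_powR// nnegrE ltW.
have {}a0 : 0 < a by exact: lt_trans ba.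
rewrite -[leLHS]add0r lerD ?powR_ge0// (powRS th a0) mulrC ler_wpM2r ?(ltW a0)//.
rewrite -opprB !powRN lef_pV2 ?posrE ?powR_gt0// ge0_ler_powR ?nnegrE ?subr_ge0//.
- by rewrite ltW.
- by rewrite ltW.
- by rewrite ltW.
Qed.

(** For q = p / (2 - p) this quotient is th = q / p - 1, and q - 1 = 2 th. The upper bound is
    equivalent to p <= 3 / 2. *)
Lemma slope_exponent_bounds (R : realType) (p : R) :
  1 <= p <= 3 / 2 -> 0 <= (p - 1) / (2 - p) <= 1.
Proof.
move=> /andP[p1 p32]; have p2 : 0 < 2 - p by lra.
by rewrite divr_ge0 ?ler_pdivrMr//; lra.
Qed.

(** The level l occurs once as a factor and once as l ^ (1 - p / 2) raised to 2 th; the identity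
    makes the total exactly l ^ p, so that only the L^p norm is needed afterwards. *)
Lemma slope_exponentE (R : realType) (p : R) : p <= 3 / 2 ->
  (1 - p / 2) * (2 * ((p - 1) / (2 - p))) = p - 1.
Proof.
move=> p32; have p2 : 2 - p != 0 by rewrite gt_eqF//; lra.
by field.
Qed.

(** For fixed [y], with l = [g y], the weighted bound reduces the power of the sublevel integral to
    l ^ (p - 1) A(t) ^ th, where A(t) is the integral over s of |t - s| times the p-th power of the
    truncated function. After linearizing A ^ th, [energy_bound] controls the integral of A by k P,
    and the factor [g y] completes l ^ p. *)
Lemma sublevel_fiber_bound (R : realType)
    (m : {finite_measure set (measurableTypeR R) -> \bar R})
    (c1 c2 : R -> R) (g : plane R -> R) (k dl p th P b : R) (y : plane R) :
  (forall A, measurable A -> m A <= lebesgue_measure A)%E ->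
  (m setT <= dl%:E)%E ->
  measurable_fun setT c1 -> measurable_fun setT c2 ->
  measurable_fun setT g -> (forall x, 0 <= g x) ->
  0 <= k -> energy_bound m c1 c2 k ->
  1 <= p <= 3 / 2 -> th = (p - 1) / (2 - p) ->
  (\int[lebesgue_measure \x lebesgue_measure]_x (g x `^ p)%:E <= P%:E)%E ->
  0 < b ->
  (\int[m]_t ((g y)%:E *
     sublevel_integral m (fun s => g ((y.1 + c1 t - c1 s)%R, (y.2 + c2 t - c2 s)%R))
       (g y) `^ (2 * th))
   <= ((2 * pi + 1) `^ (2 * th) * g y `^ p *
        (dl * b `^ th + b `^ (th - 1) * (k * P)))%:E)%E.
Proof.
move=> mL mdl mc1 mc2 mg g0 k0 Ek /andP[p1 p32] thE gP b0.
pose mR := measurableTypeR R.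
have mc1' : measurable_fun (setT : set mR) c1 := mc1.
have mc2' : measurable_fun (setT : set mR) c2 := mc2.
have p12 : 1 <= p <= 3 / 2 by rewrite p1.
have /andP[th0 th1] := slope_exponent_bounds p12; rewrite -thE in th0 th1.
(* At level 0 both sides vanish; the power identities below need a positive level. *)
have [gy0|gyN0] := eqVneq (g y) 0.
  rewrite gy0 powR0 ?mulr0 ?mul0r; last by rewrite gt_eqF// (lt_le_trans _ p1).
  by rewrite (eq_integral (fun=> 0%E)) ?integral0// => t _; rewrite mul0e.
have l0 : 0 < g y by rewrite lt_neqAle eq_sym gyN0 g0.
set l := g y in l0 *.
pose G (t s : R) := g (y.1 + c1 t - c1 s, y.2 + c2 t - c2 s).
pose K (t s : R) := if G t s <= l then G t s else 0.
have G0 t s : 0 <= G t s by exact: g0.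
have K0 t s : 0 <= K t s by rewrite /K; case: ifP.
have Kl t s : 0 <= K t s <= l by rewrite K0 /K; case: ifPn => // _; exact: ltW.
have KG t s : K t s <= G t s by rewrite /K; case: ifP.
have mG2 : measurable_fun setT (fun z : mR * mR => G z.1 z.2) by rewrite /G; meas.
have mK2 : measurable_fun setT (fun z : mR * mR => K z.1 z.2) by rewrite /K; meas.
have mK t : measurable_fun setT (K t) by rewrite /K /G; meas.
pose A (t : R) : \bar R := (\int[m]_s (`|t - s| * K t s `^ p)%:E)%E.
have A0 t : (0 <= A t)%E.
  by apply: integral_ge0 => s _; rewrite lee_fin mulr_ge0 ?powR_ge0.
have mKp : measurable_fun setT (fun z : mR * mR => (`|z.1 - z.2| * K z.1 z.2 `^ p)%:E).
  by meas.
have Kp0 (z : mR * mR) : (0 <= (`|z.1 - z.2| * K z.1 z.2 `^ p)%:E)%E.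
  by rewrite lee_fin mulr_ge0 ?powR_ge0.
have mA : measurable_fun setT (A : mR -> _).
  exact: (measurable_fun_fubini_tonelli_F _ mKp Kp0).
have mGp : measurable_fun setT
    (fun z : mR * mR => (`|z.1 - z.2|%:E * (G z.1 z.2 `^ p)%:E)%E) by meas.
have Gp0 (z : mR * mR) : (0 <= `|z.1 - z.2|%:E * (G z.1 z.2 `^ p)%:E)%E.
  by rewrite mule_ge0 ?lee_fin ?powR_ge0.
have IA : (\int[m]_t A t <= (k * P)%:E)%E.
  apply: (@le_trans _ _ (\int[m]_t \int[m]_s (`|t - s|%:E * (G t s `^ p)%:E))%E).
    apply: ge0_le_integral => //.
      exact: (measurable_fun_fubini_tonelli_F _ mGp Gp0).
    move=> t _; apply: ge0_le_integral => //.
    - by move=> s _; exact: (Kp0 (t, s)).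
    - by have mKt := mK t; meas.
    - by rewrite /G; meas.
    move=> s _; rewrite lee_fin ler_wpM2l//.
    by rewrite ge0_ler_powR ?nnegrE ?(le_trans _ p1)//.
  have mgp : measurable_fun setT (fun x : plane R => (g x `^ p)%:E) by meas.
  have gp0 x : (0 <= (g x `^ p)%:E)%E by rewrite lee_fin powR_ge0.
  apply: le_trans (Ek _ y mgp gp0) _.
  by rewrite EFinM lee_wpmul2l ?lee_fin.
set c0 := 2 * pi + 1.
have c00 : 0 < c0 by rewrite ltr_pwDr// mulr_ge0// pi_ge0.
have Hle t : (sublevel_integral m (G t) l `^ (2 * th) <=
    ((c0 * l `^ (1 - p / 2)) `^ (2 * th))%:E * A t `^ th)%E.
  have H0 : (0 <= sublevel_integral m (G t) l)%E by exact: sublevel_integral_ge0.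
  have th20 : 0 <= 2 * th by rewrite mulr_ge0.
  have := le_poweR th20 H0 (integral_le_weighted t mL (mK t) (Kl t) l0 p12).
  move=> /le_trans; apply.
  rewrite poweRM ?poweR_ge0 ?lee_fin ?mulr_ge0 ?powR_ge0 ?(ltW c00)//.
  by rewrite -poweRrM mulrA mulVf// mul1r.
have mS : measurable_fun setT (fun t : mR => sublevel_integral m (G t) l).
  apply: (@measurable_fun_fubini_tonelli_F _ _ mR mR R m
    (fun z => (K z.1 z.2)%:E)) => //; first by meas.
  by move=> z; rewrite lee_fin.
apply: (@le_trans _ _ (\int[m]_t (((c0 `^ (2 * th) * l `^ p) * b `^ th)%:E +
    ((c0 `^ (2 * th) * l `^ p) * b `^ (th - 1))%:E * A t))%E).
  apply: ge0_le_integral => //.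
  - by move=> t _; rewrite mule_ge0 ?lee_fin ?(ltW l0) ?poweR_ge0.
  - by meas.
  - by meas.
  move=> t _.
  apply: (@le_trans _ _ (l%:E * (((c0 * l `^ (1 - p / 2)) `^ (2 * th))%:E * A t `^ th))%E).
    by rewrite lee_wpmul2l// ?lee_fin ?(ltW l0)//; exact: Hle.
  rewrite muleA -EFinM.
  have -> : l * (c0 * l `^ (1 - p / 2)) `^ (2 * th) = c0 `^ (2 * th) * l `^ p.
    rewrite powRM ?powR_ge0 ?(ltW c00)// -powRrM mulrCA; congr (_ * _).
    rewrite (powRS p l0); congr (_ * l `^ _).
    by rewrite thE slope_exponentE.
  have C0 : 0 <= c0 `^ (2 * th) * l `^ p by rewrite mulr_ge0 ?powR_ge0.
  rewrite !(EFinM (c0 `^ (2 * th) * l `^ p)) -muleA -ge0_muleDr.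
  - by rewrite lee_wpmul2l ?lee_fin// poweR_le_tangent// th0.
  - by rewrite lee_fin powR_ge0.
  - by rewrite mule_ge0// lee_fin powR_ge0.
have C0 : 0 <= c0 `^ (2 * th) * l `^ p by rewrite mulr_ge0 ?powR_ge0.
rewrite ge0_integralD//; last 3 first.
- by move=> t _; rewrite lee_fin mulr_ge0 ?powR_ge0.
- by move=> t _; rewrite mule_ge0// lee_fin mulr_ge0 ?powR_ge0.
- by meas.
rewrite ge0_integralZl// ?lee_fin ?mulr_ge0 ?powR_ge0//.
rewrite (integral_cst m measurableT) mulrDr EFinD leeD//.
  rewrite (mulrC dl) mulrA [leRHS]EFinM lee_wpmul2l// lee_fin.
  by rewrite mulr_ge0 ?powR_ge0.
rewrite mulrA [leRHS]EFinM lee_wpmul2l// lee_fin.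
by rewrite mulr_ge0 ?powR_ge0.
Qed.

Lemma sigma_finite_lebesgue2 (R : realType) :
  sigma_finite setT (@lebesgue2 R).
Proof.
have /sigma_finiteP[F [TF ndF Foo]] := sigma_finiteT (@lebesgue_measure R).
exists (fun n => F n `*` F n).
  rewrite -setXTT TF predeqE => -[x y]; split; last first.
    by move=> [n _ []/= ? ?]; split; exists n.
  move=> [/= [n _ Fnx] [k _ Fky]]; exists (maxn n k) => //; split.
  - by move: x Fnx; exact/subsetPset/ndF/leq_maxl.
  - by move: y Fky; exact/subsetPset/ndF/leq_maxr.
move=> k; have [mF ?] := Foo k; split; first exact: measurableX.
rewrite [ltLHS](product_measure1E lebesgue_measure lebesgue_measure mF mF).
by rewrite lte_mul_pinfty// ge0_fin_numE.
Qed.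

(* [lebesgue2] is only inferred as a measure; the copy carries sigma-finiteness,
   which Tonelli's theorem needs below. *)
Definition planar_measure (R : realType) : set (plane R) -> \bar R :=
  @lebesgue2 R.
HB.instance Definition _ (R : realType) :=
  Measure.copy (@planar_measure R) (@lebesgue2 R).
HB.instance Definition _ (R : realType) :=
  Measure_isSigmaFinite.Build _ _ _ (@planar_measure R)
    (@sigma_finite_lebesgue2 R).

Lemma edge_bound (R : realType)
    (m : {finite_measure set (measurableTypeR R) -> \bar R})
    (c1 c2 : R -> R) (g : plane R -> R) (k dl p th P b : R) :
  (forall A, measurable A -> m A <= lebesgue_measure A)%E ->
  (m setT <= dl%:E)%E -> 0 <= dl ->
  measurable_fun setT c1 -> measurable_fun setT c2 ->
  measurable_fun setT g -> (forall x, 0 <= g x) ->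
  0 <= k -> energy_bound m c1 c2 k ->
  1 <= p <= 3 / 2 -> th = (p - 1) / (2 - p) ->
  (\int[lebesgue_measure \x lebesgue_measure]_x (g x `^ p)%:E <= P%:E)%E ->
  0 < b ->
  (\int[lebesgue_measure \x lebesgue_measure]_x
     (\int[m]_t (g ((x.1 - c1 t)%R, (x.2 - c2 t)%R))%:E) `^ (1 + 2 * th)
   <= (4 `^ (1 + 2 * th) * ((2 * pi + 1) `^ (2 * th) *
        (dl * b `^ th + b `^ (th - 1) * (k * P))) * P)%:E)%E.
Proof.
move=> mL mdl dl0 mc1 mc2 mg g0 k0 Ek p12 thE gP b0.
pose mR := measurableTypeR R; pose lam2 : {sigma_finite_measure set _ -> \bar R} := @planar_measure R.
have mc1' : measurable_fun (setT : set mR) c1 := mc1.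
have mc2' : measurable_fun (setT : set mR) c2 := mc2.
have /andP[th0 th1] := slope_exponent_bounds p12; rewrite -thE in th0 th1.
have th20 : 0 <= 2 * th by rewrite mulr_ge0.
have mgp : measurable_fun setT (fun x : plane R => (g x `^ p)%:E) by meas.
have gp0 x : (0 <= (g x `^ p)%:E)%E by rewrite lee_fin powR_ge0.
have P0 : 0 <= P by rewrite -lee_fin (le_trans _ gP)//; exact: integral_ge0.
pose gc (x : plane R) (t : R) := g (x.1 - c1 t, x.2 - c2 t).
pose kk (a b : R) := if b <= a then b else 0.
have kk0 x y : 0 <= kk (g x) (g y) by rewrite /kk; case: ifP.
(* [Ph] and [Ps] are the same integrand before and after translating the plane by the point of the
   curve at time t, which turns [gc x t] into [g y]. *)
pose Ph (z : plane R * mR) : \bar R :=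
  ((gc z.1 z.2)%:E * (\int[m]_s (kk (gc z.1 z.2) (gc z.1 s))%:E) `^ (2 * th))%E.
pose Ps (z : plane R * mR) : \bar R := ((g z.1)%:E * (\int[m]_s
  (kk (g z.1) (g ((z.1.1 + c1 z.2 - c1 s)%R, (z.1.2 + c2 z.2 - c2 s)%R)))%:E) `^ (2 * th))%E.
have Ph0 z : (0 <= Ph z)%E by rewrite mule_ge0 ?lee_fin ?poweR_ge0// /gc.
have Ps0 z : (0 <= Ps z)%E by rewrite mule_ge0 ?lee_fin ?poweR_ge0.
have mPh : measurable_fun setT Ph.
  have mI : measurable_fun setT (fun z : plane R * mR =>
      \int[m]_s (kk (gc z.1 z.2) (gc z.1 s))%:E)%E.
    apply: (@measurable_fun_fubini_tonelli_F _ _ _ mR R m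
      (fun w : (plane R * mR) * mR => (kk (gc w.1.1 w.1.2) (gc w.1.1 w.2))%:E)).
      by rewrite /kk /gc; meas.
    by move=> w; rewrite lee_fin; exact: kk0.
  by rewrite /Ph /gc; rewrite /gc in mI; meas.
have mPs : measurable_fun setT Ps.
  have mI : measurable_fun setT (fun z : plane R * mR => \int[m]_s
      (kk (g z.1) (g ((z.1.1 + c1 z.2 - c1 s)%R, (z.1.2 + c2 z.2 - c2 s)%R)))%:E)%E.
    apply: (@measurable_fun_fubini_tonelli_F _ _ _ mR R m
      (fun w : (plane R * mR) * mR => (kk (g w.1.1)
        (g (w.1.1.1 + c1 w.1.2 - c1 w.2, w.1.1.2 + c2 w.1.2 - c2 w.2)))%:E)).
      by rewrite /kk; meas.
    by move=> w; rewrite lee_fin.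
  by rewrite /Ps; meas.
have mgc x : measurable_fun setT (gc x : mR -> R) by rewrite /gc; meas.
have mT : measurable_fun setT (fun x => \int[m]_t (gc x t)%:E)%E.
  apply: (@measurable_fun_fubini_tonelli_F _ _ _ mR R m
      (fun w : plane R * mR => (gc w.1 w.2)%:E)).
    by rewrite /gc; meas.
  by move=> w; rewrite lee_fin /gc.
apply: (@le_trans _ _ ((4 `^ (1 + 2 * th))%:E * \int[lam2]_x \int[m]_t Ph (x, t))%E).
  rewrite -ge0_integralZl ?lee_fin ?powR_ge0//; last 2 first.
  - exact: (measurable_fun_fubini_tonelli_F _ mPh Ph0).
  - by move=> x _; apply: integral_ge0.
  apply: ge0_le_integral => //.
  - by move=> x _; exact: poweR_ge0.
  - by meas.
  - apply: measurable_funeM.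
    exact: (measurable_fun_fubini_tonelli_F _ mPh Ph0).
  move=> x _.
  have q1 : 1 <= 1 + 2 * th by rewrite lerDl.
  have := le_integral_sublevel_power m (mgc x) (fun t => g0 _) q1.
  by rewrite (addrC 1) addrK.
rewrite -[leRHS]/(((_ * _) * _)%:E) -mulrA [leRHS]EFinM lee_wpmul2l ?lee_fin ?powR_ge0//.
(* The translation depends on t, so t has to be the outer variable here; the order is restored once
   the translation is done. *)
rewrite (fubini_tonelli _ mPh Ph0).
apply: (@le_trans _ _ (\int[m]_t \int[lam2]_x Ps (x, t))%E).
  apply: ge0_le_integral => //.
  - by move=> t _; apply: integral_ge0.
  - exact: (measurable_fun_fubini_tonelli_G _ mPh Ph0).
  - exact: (measurable_fun_fubini_tonelli_G _ mPs Ps0).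
  move=> t _.
  have mPst : measurable_fun setT (fun x : plane R => Ps (x, t)).
    by apply: (measurableT_comp mPs); exact: measurable_fun_pair.
  apply: le_trans (ge0_integral_translation2_le (c1 t) (c2 t) mPst (fun x => Ps0 _)).
  rewrite le_eqVlt; apply/orP; left; apply/eqP; apply: eq_integral => x _.
  rewrite /Ps /Ph /gc /=; congr (_ * _ `^ _)%E; apply: eq_integral => s _.
  by rewrite !subrK.
rewrite -(fubini_tonelli _ mPs Ps0).
set B := dl * b `^ th + _.
have B0 : 0 <= B.
  by rewrite addr_ge0// mulr_ge0 ?powR_ge0// mulr_ge0.
apply: (@le_trans _ _ (\int[lam2]_x (((2 * pi + 1) `^ (2 * th) * B)%:E * (g x `^ p)%:E))%E).
  apply: ge0_le_integral => //.
  - by move=> x _; apply: integral_ge0.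
  - exact: (measurable_fun_fubini_tonelli_F _ mPs Ps0).
  - by meas.
  move=> y _; rewrite -EFinM mulrAC.
  exact: (sublevel_fiber_bound y mL mdl mc1 mc2 mg g0 k0 Ek p12 thE gP b0).
rewrite ge0_integralZl ?lee_fin ?mulr_ge0 ?powR_ge0//.
by rewrite [leRHS]EFinM lee_wpmul2l// lee_fin mulr_ge0 ?powR_ge0.
Qed.

(* The optimal [b] is [k * P / dl], which equalizes the two terms of
   [edge_bound]. *)
Lemma strong_type_edge (R : realType)
    (m : {finite_measure set (measurableTypeR R) -> \bar R})
    (c1 c2 : R -> R) (g : plane R -> R) (k dl p th P : R) :
  (forall A, measurable A -> m A <= lebesgue_measure A)%E ->
  (m setT <= dl%:E)%E -> 0 < dl ->
  measurable_fun setT c1 -> measurable_fun setT c2 ->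
  measurable_fun setT g -> (forall x, 0 <= g x) ->
  0 < k -> energy_bound m c1 c2 k ->
  1 <= p <= 3 / 2 -> th = (p - 1) / (2 - p) -> 0 <= P ->
  (\int[lebesgue_measure \x lebesgue_measure]_x (g x `^ p)%:E <= P%:E)%E ->
  (\int[lebesgue_measure \x lebesgue_measure]_x
     (\int[m]_t (g ((x.1 - c1 t)%R, (x.2 - c2 t)%R))%:E) `^ (1 + 2 * th)
   <= (4 `^ (1 + 2 * th) * (2 * pi + 1) `^ (2 * th) * 2 *
        (dl `^ (1 - th) * k `^ th * P `^ (1 + th)))%:E)%E.
Proof.
move=> mL mdl dl0 mc1 mc2 mg g0 k0 Ek p12 thE P0 gP.
have /andP[th0 th1] := slope_exponent_bounds p12; rewrite -thE in th0 th1.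
have edge := edge_bound mL mdl (ltW dl0) mc1 mc2 mg g0 (ltW k0) Ek p12 thE gP.
(* For P = 0 the optimal b would be 0, which is not admissible; b = 1 serves, since the bound is a
   multiple of P. *)
have [P00|PN0] := eqVneq P 0.
  apply: le_trans (edge _ ltr01) _.
  by rewrite P00 !mulr0 powR0 ?mulr0// gt_eqF// ltr_pwDl.
have {}P0 : 0 < P by rewrite lt_neqAle eq_sym PN0.
have b0 : 0 < k * P / dl by rewrite divr_gt0// mulr_gt0.
apply: le_trans (edge _ b0) _; rewrite lee_fin le_eqVlt; apply/orP; left; apply/eqP.
have kP : 0 < k * P by rewrite mulr_gt0.
have E1 : dl * (k * P / dl) `^ th = dl `^ (1 - th) * (k * P) `^ th.
  rewrite powRM ?invr_ge0 ?(ltW kP) ?(ltW dl0)//.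
  rewrite -(powR_inv1 (ltW dl0)) -powRrM mulN1r mulrCA.
  by rewrite powRD ?(gt_eqF dl0) ?implybT// powRr1 ?(ltW dl0)// mulrC.
have E2 : (k * P / dl) `^ (th - 1) * (k * P) = dl `^ (1 - th) * (k * P) `^ th.
  rewrite -E1 (powRS th b0) [RHS]mulrA [dl * _]mulrC divfK ?gt_eqF//.
  by rewrite mulrC.
have E3 : P `^ (1 + th) = P * P `^ th.
  by rewrite powRD ?(gt_eqF P0) ?implybT// powRr1 ?ltW.
rewrite E1 E2 E3 powRM ?ltW//; ring.
Qed.

(** * Curved arcs *)

(** Moves the restriction from the measure into the integrand, so that Tonelli's theorem and
    translations on the whole line become available. *)
Lemma ge0_integral_mrestr (R : realType) (J : set (measurableTypeR R))
    (mJ : measurable J) (f : measurableTypeR R -> \bar R) :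
  measurable_fun setT f -> (forall x, 0 <= f x)%E ->
  (\int[mrestr lebesgue_measure mJ]_x f x =
   \int[lebesgue_measure]_x ((\1_J x)%:E * f x))%E.
Proof.
move=> mf f0.
have mCJ : measurable (~` J) by exact: measurableC.
have nCJ : mrestr (@lebesgue_measure R) mJ (~` J) = 0%E.
  by rewrite /mrestr setICl measure0.
rewrite (@ge0_negligible_integral _ _ _ _ setT _ _ mCJ measurableT)//.
rewrite setTD setCK (@eq_measure_integral _ _ _ J (@lebesgue_measure R)); last first.
  by move=> A mA AJ; rewrite /= /mrestr setIidl.
rewrite integral_mkcond; apply: eq_integral => x _.
by rewrite patchE indicE; case: ifP => _; rewrite ?mul1e ?mul0e.
Qed.

(** An integrated form of a lower bound [ka] for the absolute second derivative. For fixed [v] it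
    says that s -> gam (s + v) - gam s expands distances by [ka * |v|]. *)
Definition curved_on (R : realType) (J : set R) (ka : R) (gam : R -> R) :=
  forall v s t, J s -> J (s + v) -> J t -> J (t + v) ->
  ka * `|v| * `|s - t| <= `|gam (s + v) - gam s - (gam (t + v) - gam t)|.

(** Put t = s + v. The first coordinate then depends on v alone, and for fixed v the second one is a
    function of s expanding by u ka |v|; the factor |v| cancels the weight. The remaining integral
    in v costs 1 / u, and u ^ 2 >= 1 leaves [ka^-1]. *)
Lemma energy_bound_curve (R : realType) (J : set (measurableTypeR R))
    (mJ : measurable J) (gam : R -> R) (ka u : R) :
  measurable_fun setT gam -> 0 < ka -> 1 <= u -> curved_on J ka gam ->
  energy_bound (mrestr lebesgue_measure mJ) (fun t => u * t)
    (fun t => u * gam t) ka^-1.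
Proof.
move=> mgam ka0 u1 Jgam h y mh h0; pose mR := measurableTypeR R.
have u0 : 0 < u by exact: lt_le_trans u1.
have mgam' : measurable_fun (setT : set mR) gam := mgam.
have mI : measurable_fun setT (\1_J : mR -> R) by exact: measurable_indic.
pose G (t s : R) : \bar R :=
  (`|t - s|%:E * h (y.1 + u * t - u * s, y.2 + u * gam t - u * gam s)%R)%E.
have G0 t s : (0 <= G t s)%E by rewrite mule_ge0.
have mG : measurable_fun setT (fun z : mR * mR => G z.1 z.2) by rewrite /G; meas.
pose F (z : mR * mR) : \bar R := ((\1_J z.1)%:E * ((\1_J z.2)%:E * G z.1 z.2))%E.
have i0 (x : mR) : (0 <= (\1_J x : R)%:E)%E by rewrite lee_fin.
have F0 z : (0 <= F z)%E by rewrite !mule_ge0.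
have mF : measurable_fun setT F by rewrite /F; meas.
pose F1 (z : mR * mR) := F (z.2 + z.1, z.2).
have mF1 : measurable_fun setT F1 by rewrite /F1; meas.
have F10 z : (0 <= F1 z)%E by exact: F0.
pose k (x : mR) := (\int[lebesgue_measure]_w h (x, w))%E.
have mk : measurable_fun setT k by exact: (measurable_fun_fubini_tonelli_F _ mh).
have k0 x : (0 <= k x)%E by exact: integral_ge0.
have -> : (\int[mrestr lebesgue_measure mJ]_t \int[mrestr lebesgue_measure mJ]_s
    (`|t - s|%:E * h (y.1 + u * t - u * s, y.2 + u * gam t - u * gam s)%R) =
    \int[lebesgue_measure]_t \int[lebesgue_measure]_s F (t, s))%E.
  have mGt t : measurable_fun setT (G t : mR -> _) by rewrite /G; meas.
  have mG' : measurable_fun setT (fun z : mR * mR => ((\1_J z.2)%:E * G z.1 z.2)%E).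
    by meas.
  have G'0 (z : mR * mR) : (0 <= (\1_J z.2)%:E * G z.1 z.2)%E by rewrite mule_ge0.
  rewrite (eq_integral (fun t : mR => \int[lebesgue_measure]_s ((\1_J s)%:E * G t s))%E); last first.
    by move=> t _; rewrite (ge0_integral_mrestr _ (mGt t)).
  rewrite ge0_integral_mrestr//; last 2 first.
  - exact: (measurable_fun_fubini_tonelli_F _ mG' G'0).
  - by move=> t; apply: integral_ge0 => s _; exact: (G'0 (t, s)).
  apply: eq_integral => t _; rewrite -ge0_integralZl//.
  - by have mGt' := mGt t; meas.
  - by move=> s _; exact: (G'0 (t, s)).
rewrite (fubini_tonelli _ mF F0).
apply: (@le_trans _ _ (\int[lebesgue_measure]_s \int[lebesgue_measure]_v F1 (v, s))%E).
  apply: ge0_le_integral => //.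
  - by move=> s _; exact: integral_ge0.
  - exact: (measurable_fun_fubini_tonelli_G _ mF F0).
  - exact: (measurable_fun_fubini_tonelli_G _ mF1 F10).
  move=> s _.
  have mF1s : measurable_fun setT (fun v : mR => F1 (v, s)).
    by apply: (measurableT_comp mF1); exact: measurable_fun_pair.
  apply: le_trans (ge0_integral_translation_le s mF1s (fun v => F10 _)).
  rewrite le_eqVlt; apply/orP; left; apply/eqP; apply: eq_integral => t _.
  by rewrite /F1/= addrC subrK.
rewrite -(fubini_tonelli _ mF1 F10).
have uka : 0 < u * ka by rewrite mulr_gt0.
have mku : measurable_fun setT (fun v : mR => k (y.1 + u * v)) by meas.
apply: (@le_trans _ _ ((u * ka)^-1%:E * \int[lebesgue_measure]_v k (y.1 + u * v)%R)%E).
  rewrite -ge0_integralZl//; last by rewrite lee_fin invr_ge0 ltW.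
  apply: ge0_le_integral => //.
  - by move=> v _; exact: integral_ge0.
  - exact: (measurable_fun_fubini_tonelli_F _ mF1 F10).
  - by meas.
  move=> v _.
  have F1E s : F1 (v, s) = (`|v|%:E * ((\1_J (s + v) * \1_J s : R)%:E *
      h (y.1 + u * v, y.2 + u * gam (s + v) - u * gam s)%R))%E.
    rewrite /F1 /F /G/= (_ : s + v - s = v); last by ring.
    rewrite (_ : y.1 + u * (s + v) - u * s = y.1 + u * v); last by ring.
    by rewrite EFinM !muleA; congr (_ * _)%E; rewrite muleC !muleA.
  (* At v = 0 the expansion constant degenerates, but the weight |v| makes the integrand vanish. *)
  have [v00|vN0] := eqVneq v 0.
    rewrite (eq_integral (fun _ : mR => 0%E)); last first.
      by move=> s _; rewrite (F1E s) v00 normr0 mul0e.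
    by rewrite integral0 mule_ge0// lee_fin invr_ge0 ltW.
  have v0 : 0 < `|v| by rewrite normr_gt0.
  (* The s for which both s and t = s + v lie in [J]: there the curvature hypothesis applies. *)
  pose Jv : set mR := (fun s => s + v) @^-1` J `&` J.
  have mJv : measurable Jv.
    apply: measurableI => //; rewrite -[_ @^-1` _]setTI.
    have : measurable_fun (setT : set mR) (fun s : mR => s + v : mR) by meas.
    exact.
  pose hv (w : mR) := h (y.1 + u * v, w).
  have mhv : measurable_fun setT hv by rewrite /hv; meas.
  pose phi (s : R) := y.2 + u * gam (s + v) - u * gam s.
  have mphi : measurable_fun setT phi by rewrite /phi; meas.
  have := @ge0_integral_expansive R Jv (u * ka * `|v|) phi hv mJv.
  rewrite mulr_gt0// => /(_ isT mphi) expv.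
  rewrite (eq_integral (fun s : mR => `|v|%:E * ((\1_J (s + v) * \1_J s : R)%:E * hv (phi s)))%E); last first.
    by move=> s _; rewrite F1E.
  have mI2 : measurable_fun setT (fun s : mR => ((\1_J (s + v) * \1_J s : R)%:E * hv (phi s))%E).
    by meas.
  rewrite ge0_integralZl//; last first.
    by move=> s _; apply: mule_ge0; [rewrite lee_fin mulr_ge0|exact: h0].
  have -> : (\int[lebesgue_measure]_s ((\1_J (s + v) * \1_J s : R)%:E * hv (phi s)) =
      \int[lebesgue_measure]_(s in Jv) hv (phi s))%E.
    rewrite [RHS]integral_mkcond; apply: eq_integral => s _.
    rewrite patchE !indicE /Jv in_setI.
    have -> : (s \in (fun s => s + v) @^-1` J) = (s + v \in J) by [].
    by case: (_ \in _); case: (_ \in _); rewrite ?mul0r ?mulr0 ?mul1r ?mul0e ?mul1e.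
  have Jve : expansive_on Jv (u * ka * `|v|) phi.
    move=> s t [Jsv Js] [Jtv Jt].
    have -> : phi s - phi t = u * (gam (s + v) - gam s - (gam (t + v) - gam t)).
      by rewrite /phi; ring.
    by rewrite normrM (gtr0_norm u0) -!mulrA ler_wpM2l ?(ltW u0)// mulrA Jgam.
  have le1 := expv Jve mhv (fun w => h0 _).
  have v0e : (0 <= `|v|%:E)%E by rewrite lee_fin.
  apply: le_trans (lee_wpmul2l v0e le1) _.
  rewrite muleA -EFinM (_ : `|v| / (u * ka * `|v|) = (u * ka)^-1)//.
  by rewrite invfM mulrCA divff ?mulr1 ?gt_eqF.
have mkv : measurable_fun setT (fun v : mR => y.1 + u * v : R) by meas.
have uexp : expansive_on setT u (fun v => y.1 + u * v).
  move=> s t _ _; rewrite (_ : y.1 + u * s - (y.1 + u * t) = u * (s - t)); last by ring.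
  by rewrite normrM (gtr0_norm u0).
have ki := ge0_integral_expansive measurableT u0 mkv uexp mk k0.
have uka0 : (0 <= (u * ka)^-1%:E)%E by rewrite lee_fin invr_ge0 ltW.
apply: le_trans (lee_wpmul2l uka0 ki) _.
rewrite muleA -EFinM fubini_tonelli1// lee_wpmul2r//.
  by apply: integral_ge0 => x _; exact: k0.
rewrite lee_fin -invfM lef_pV2 ?posrE ?mulr_gt0// mulrAC.
by rewrite -[leLHS]mul1r ler_wpM2r ?(ltW ka0)// mulr_ege1.
Qed.

(** Jensen's inequality, obtained from Hoelder's inequality against the constant 1; r = 1 is
    separate because its conjugate exponent is infinite. *)
Lemma power_integral_le d (T : measurableType d) (R : realType)
    (m : {finite_measure set T -> \bar R}) (F : T -> R) (dl r : R) :
  measurable_fun setT F -> (forall t, 0 <= F t) -> 1 <= r -> 0 <= dl ->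
  (m setT <= dl%:E)%E ->
  ((\int[m]_t (F t)%:E) `^ r <=
    (dl `^ (r - 1))%:E * \int[m]_t (F t `^ r)%:E)%E.
Proof.
move=> mF F0 r1 dl0 mdl; have r0 : 0 < r by exact: lt_le_trans r1.
have I0 : (0 <= \int[m]_t (F t)%:E)%E by apply: integral_ge0 => t _; rewrite lee_fin.
have Ir0 : (0 <= \int[m]_t (F t `^ r)%:E)%E.
  by apply: integral_ge0 => t _; rewrite lee_fin powR_ge0.
have [->|rN1] := eqVneq r 1.
  rewrite subrr powRr0 mul1e poweRe1//.
  rewrite le_eqVlt; apply/orP; left; apply/eqP; apply: eq_integral => t _.
  by rewrite powRr1.
have r1' : 0 < r - 1 by rewrite subr_gt0 lt_neqAle eq_sym rN1.
pose r' := r / (r - 1).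
have r'0 : 0 < r' by rewrite divr_gt0.
have rr' : r^-1 + r'^-1 = 1.
  by rewrite /r' invf_div -{1}[r^-1]mul1r -mulrDl addrC subrK divff ?gt_eqF.
have m1 : measurable_fun setT (cst (1 : R) : T -> R) by exact: measurable_cst.
have := hoelder m mF m1 r0 r'0 rr'.
rewrite Lnorm1 (eq_integral (fun t => (F t)%:E)); last first.
  by move=> t _; rewrite /= mulr1 ger0_norm.
have -> : ('N[m]_r%:E[EFin \o F] = (\int[m]_t (F t `^ r)%:E) `^ r^-1)%E.
  rewrite unlock; congr (_ `^ _)%E; apply: eq_integral => t _.
  by rewrite /= ger0_norm.
have -> : ('N[m]_r'%:E[EFin \o cst 1%R] = (m setT) `^ r'^-1)%E.
  exact: Lnorm_cst1.
move=> /(le_poweR (ltW r0) I0) /le_trans; apply.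
rewrite poweRM ?poweR_ge0// -!poweRrM mulVf ?gt_eqF// poweRe1// muleC.
rewrite lee_wpmul2r//.
have -> : r'^-1 * r = r - 1.
  by rewrite /r' invf_div divfK// gt_eqF.
by rewrite -poweR_EFin le_poweR// ltW.
Qed.

(* A point of the triangle is [r^-1] times a point of its edge [1/q = 2/p - 1],
   and Jensen's inequality transfers the bound for [g `^ r] there to [g]. *)
Lemma strong_type_triangle (R : realType) (p q : R) :
  1 <= p -> p <= q -> q <= 2 * p -> 2 / p - 1 <= q^-1 ->
  exists2 C : R, 0 < C &
  forall (m : {finite_measure set (measurableTypeR R) -> \bar R})
    (c1 c2 : R -> R) (g : plane R -> R) (k dl P : R),
  (forall A, measurable A -> m A <= lebesgue_measure A)%E ->
  (m setT <= dl%:E)%E -> 0 < dl ->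
  measurable_fun setT c1 -> measurable_fun setT c2 ->
  measurable_fun setT g -> (forall x, 0 <= g x) ->
  0 < k -> energy_bound m c1 c2 k -> 0 <= P ->
  (\int[lebesgue_measure \x lebesgue_measure]_x (g x `^ p)%:E <= P%:E)%E ->
  (\int[lebesgue_measure \x lebesgue_measure]_x
     (\int[m]_t (g ((x.1 - c1 t)%R, (x.2 - c2 t)%R))%:E) `^ q
   <= (C * (dl `^ (q - 3 * (q / p - 1)) * k `^ (q / p - 1) * P `^ (q / p)))%:E)%E.
Proof.
move=> p1 pq q2p pq1.
have p0 : 0 < p by exact: lt_le_trans p1.
have q0 : 0 < q by exact: lt_le_trans pq.
pose th := q / p - 1.
(* The ray from the origin through (1/p, 1/q) meets the edge at (1/pe, 1/qe), and p = r pe, q = r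
   qe. The hypotheses translate one by one: p <= q is pe >= 1, q <= 2 p is pe <= 3 / 2, and 2 / p -
   1 <= 1 / q is r >= 1. *)
pose pe := 2 - p / q; pose qe := 1 + 2 * th; pose r := p / pe.
have pq01 : p / q <= 1 by rewrite ler_pdivrMr// mul1r.
have pq02 : 2^-1 <= p / q by rewrite ler_pdivlMr// ler_pdivrMl.
have pe1 : 1 <= pe by rewrite /pe; lra.
have pe0 : 0 < pe by exact: lt_le_trans pe1.
have pe2 : pe <= 3 / 2 by rewrite /pe; lra.
have thE : th = (pe - 1) / (2 - pe).
  have -> : pe - 1 = 1 - p / q by rewrite /pe; lra.
  have -> : 2 - pe = p / q by rewrite /pe; lra.
  rewrite invf_div mulrBl mul1r /th; congr (_ - _).
  by rewrite mulrA divfK ?divff ?gt_eqF.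
have r1 : 1 <= r.
  rewrite ler_pdivlMr// mul1r /pe lerBlDr -lerBlDl.
  have := ler_wpM2l (ltW p0) pq1.
  by rewrite mulrBr mulr1 mulrCA divff ?gt_eqF// mulr1.
have qE : q = r * qe.
  rewrite /r /qe /th /pe; field; rewrite !gt_eqF//=.
  by rewrite subr_gt0 (le_lt_trans _ (_ : q < 2 * q))//; lra.
have peE : p = r * pe by rewrite /r divfK ?gt_eqF.
have th0 : 0 <= th by rewrite subr_ge0 ler_pdivlMr// mul1r.
have qe0 : 0 < qe by rewrite ltr_pwDl// mulr_ge0.
have r0 : 0 < r by exact: lt_le_trans r1.
exists (4 `^ qe * (2 * pi + 1) `^ (2 * th) * 2).
  by rewrite !mulr_gt0 ?powR_gt0// ltr_pwDr// mulr_ge0// pi_ge0.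
move=> m c1 c2 g k dl P mL mdl dl0 mc1 mc2 mg g0 k0 Ek P0 gP.
pose mR := measurableTypeR R.
have mc1' : measurable_fun (setT : set mR) c1 := mc1.
have mc2' : measurable_fun (setT : set mR) c2 := mc2.
have mgr : measurable_fun setT (fun x => g x `^ r) by meas.
have gr0 x : 0 <= g x `^ r by exact: powR_ge0.
have p12 : 1 <= pe <= 3 / 2 by rewrite pe1.
have := @strong_type_edge R m c1 c2 (fun x => g x `^ r) k dl pe th P mL mdl dl0
  mc1 mc2 mgr gr0 k0 Ek p12 thE P0.
rewrite (eq_integral (fun x : plane R => (g x `^ p)%:E)); last first.
  by move=> x _; rewrite -powRrM -peE.
move=> /(_ gP); set I1 := (\int[_]_x _)%E => edge.
apply: (@le_trans _ _ ((dl `^ ((r - 1) * qe))%:E * I1)%E); last first.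
  apply: le_trans (lee_wpmul2l _ edge) _; first by rewrite lee_fin powR_ge0.
  rewrite -EFinM lee_fin le_eqVlt; apply/orP; left; apply/eqP.
  (* The first summand is the cost of Jensen's inequality, the second is the power of [dl] on the
     edge. *)
  have -> : q - 3 * (q / p - 1) = (r - 1) * qe + (1 - th).
    by rewrite mulrBl -qE -/th /qe; lra.
  have -> : q / p = 1 + th by rewrite /th addrC subrK.
  rewrite (_ : 1 + th - 1 = th); last by lra.
  rewrite (powRD (r := (r - 1) * qe)) ?(gt_eqF dl0) ?implybT// -/qe.
  ring.
have mTr : measurable_fun setT (fun x : plane R =>
    \int[m]_t (g (x.1 - c1 t, x.2 - c2 t)%R `^ r)%:E)%E.
  apply: (@measurable_fun_fubini_tonelli_F _ _ _ mR R m
      (fun w : plane R * mR => (g (w.1.1 - c1 w.2, w.1.2 - c2 w.2) `^ r)%:E)).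
    by meas.
  by move=> w; rewrite lee_fin.
have mT : measurable_fun setT (fun x : plane R =>
    \int[m]_t (g (x.1 - c1 t, x.2 - c2 t)%R)%:E)%E.
  apply: (@measurable_fun_fubini_tonelli_F _ _ _ mR R m
      (fun w : plane R * mR => (g (w.1.1 - c1 w.2, w.1.2 - c2 w.2))%:E)).
    by meas.
  by move=> w; rewrite lee_fin.
rewrite /I1 -ge0_integralZl ?lee_fin ?powR_ge0//; last 2 first.
- by meas.
- by move=> x _; exact: poweR_ge0.
apply: ge0_le_integral => //.
- by move=> x _; exact: poweR_ge0.
- by meas.
- by meas.
move=> x _.
rewrite qE poweRrM powRrM -poweR_EFin -poweRM ?lee_fin ?powR_ge0//; last first.
  by apply: integral_ge0 => t _; rewrite lee_fin.
apply: le_poweR; [exact: ltW|exact: poweR_ge0|].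
apply: power_integral_le => //; [|exact: ltW].
by meas.
Qed.

(** * Curvature of gamma *)

Lemma derivable_in_cvg (R : realType) (D : set R) (f : R -> R) (t : R) :
  derivable_in D f -> D t -> forall e : R, 0 < e -> exists2 d : R, 0 < d &
    forall s, D s -> s != t -> `|s - t| < d ->
      `|derive_in D f t - diff_quot f t s| < e.
Proof.
move=> Df Dt e e0.
have [d d0 H] : \forall s \near t, s != t -> D s ->
    `|derive_in D f t - diff_quot f t s| < e.
  by have /cvgrPdist_lt/(_ e e0) := Df t Dt; apply.
exists d => // s Ds st sd; apply: H => //=.
by rewrite distrC.
Qed.

(** At interior points the relative derivative is the ordinary one, which gives access to the mean
    value theorem: it asks for derivatives on the open interval only, so the endpoint 1 causes no
    trouble. *)
Lemma derivable_in_is_derive (R : realType) (D : set R) (f : R -> R) (t : R) :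
  derivable_in D f -> D t -> nbhs t D -> is_derive t 1 f (derive_in D f t).
Proof.
move=> Df Dt [d1 d10 td1].
have cv : (fun h => h^-1 *: ((f \o shift t) (h *: 1) - f t)) @ 0^' -->
    derive_in D f t.
  apply/cvgrPdist_lt => e e0; have [d d0 H] := derivable_in_cvg Df Dt e0.
  have m0 : 0 < Num.min d d1 by rewrite lt_min d0.
  exists (Num.min d d1) => //= h; rewrite /ball_/= sub0r normrN lt_min => /andP[hd hd1] hN0.
  have := H (h + t); rewrite addrK /diff_quot addrK.
  rewrite [h *: 1]mulr1 [X in `|_ - X|]mulrC; apply => //.
  - by apply: td1 => /=; rewrite opprD addrCA subrr addr0 normrN.
  - by rewrite -subr_eq0 addrK.
split; first by apply/cvg_ex; eexists; exact: cv.
exact: cvg_lim cv.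
Qed.

Lemma derivable_in_continuous (R : realType) (D : set R) (f : R -> R) :
  derivable_in D f -> {within D, continuous f}.
Proof.
move=> Df; apply/subspace_continuousP => t Dt.
apply/cvgrPdist_lt => e e0.
have [d d0 H] := derivable_in_cvg Df Dt ltr01.
set l := derive_in D f t in H.
have l1 : 0 < `|l| + 1 by rewrite ltr_pwDr.
have m0 : 0 < Num.min d (e / (`|l| + 1)) by rewrite lt_min d0 divr_gt0.
exists (Num.min d (e / (`|l| + 1))) => //= s; rewrite /ball_/= lt_min distrC => /andP[sd se] Ds.
have [->|st] := eqVneq s t; first by rewrite subrr normr0.
have := H s Ds st sd; rewrite /diff_quot => Hs.
have st0 : s - t != 0 by rewrite subr_eq0.
have ql : `|(f s - f t) / (s - t)| < `|l| + 1.
  rewrite -[X in `|X|](subKr l) (le_lt_trans (ler_normB _ _))// ltrD2l.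
  exact: Hs.
change (`|f t - f s| < e).
rewrite distrC -(divfK st0 (f s - f t)) normrM.
rewrite (le_lt_trans (ler_wpM2r (normr_ge0 _) (ltW ql)))//.
by rewrite mulrC -ltr_pdivlMr.
Qed.

Lemma within_continuous_shift (R : realType) (D A : set R) (f : R -> R) (v : R) :
  {within D, continuous f} -> (forall x, A x -> D (x + v)) ->
  {within A, continuous (fun x => f (x + v))}.
Proof.
move=> /subspace_continuousP fD AD; apply/subspace_continuousP => x Ax.
apply/cvgrPdist_lt => e e0.
have [d d0 H] : \forall s \near x + v, D s -> `|f (x + v) - f s| < e.
  by have /cvgrPdist_lt/(_ e e0) := fD _ (AD _ Ax); apply.
exists d => //= s /= sd As; apply: H; last exact: AD.
by rewrite /ball_/= opprD addrACA subrr addr0.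
Qed.

Lemma nbhs_half_open (R : realType) (x : R) : 0 < x -> x < 1 ->
  nbhs x (`]0, 1]%classic : set R).
Proof.
move=> x0 x1; have : `]0, 1[%classic `<=` (`]0, 1]%classic : set R).
  by move=> y /=; rewrite !in_itv/= => /andP[-> /ltW].
move=> /filterS; apply; apply: open_nbhs_nbhs; split; first exact: interval_open.
by rewrite /= in_itv/= x0.
Qed.

(** The mean value theorem is applied twice: to x -> gamma (x + v) - gamma x on [s, t], then to the
    first derivative on [xi, xi + v]. This produces v (t - s) times a value of the second derivative
    inside ]a, b]. *)
Lemma second_difference_bound (R : realType) (gamma : R -> R) (a b ka : R) :
  let D := `]0, 1]%classic : set R in
  0 <= a -> b <= 1 -> 0 <= ka ->
  derivable_in D gamma -> derivable_in D (derive_in D gamma) ->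
  (forall t, a < t -> t <= b -> ka <= `|derive_in D (derive_in D gamma) t|) ->
  curved_on `]a, b]%classic ka gamma.
Proof.
move=> D a0 b1 ka0 D1 D2 kab.
have cont1 := derivable_in_continuous D1.
have cont2 := derivable_in_continuous D2.
have inD x : a < x -> x <= b -> D x.
  by move=> ax xb; rewrite /D/= in_itv/= (le_lt_trans a0 ax) (le_trans xb b1).
have nD x : a < x -> x < b -> nbhs x D.
  by move=> ax xb; apply: nbhs_half_open; [exact: le_lt_trans ax|exact: lt_le_trans b1].
have core v s t : 0 < v -> s < t -> a < s -> t + v <= b ->
    ka * v * (t - s) <= `|gamma (t + v) - gamma t - (gamma (s + v) - gamma s)|.
  move=> v0 st as_ tvb.
  pose f x := gamma (x + v) - gamma x.
  pose df x := derive_in D gamma (x + v) - derive_in D gamma x.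
  have fdf x : x \in `]s, t[%R -> is_derive x 1 f (df x).
    rewrite in_itv/= => /andP[sx xt].
    have ax : a < x by exact: lt_trans sx.
    have xvb : x + v < b by rewrite (lt_le_trans _ tvb)// ltrD2r.
    have xv : x < x + v by rewrite ltrDl.
    have axv : a < x + v by exact: lt_trans xv.
    have xb : x < b by exact: lt_trans xvb.
    have g1 := derivable_in_is_derive D1 (inD _ axv (ltW xvb)) (nD _ axv xvb).
    have g2 := derivable_in_is_derive D1 (inD _ ax (ltW xb)) (nD _ ax xb).
    apply: is_deriveB.
    have := @is_derive1_comp R gamma (fun x => x + v) x (derive_in D gamma (x + v)) 1 g1.
    rewrite mulr1; apply.
    by apply: is_derive_eq; rewrite addr0.
  have cf : {within `[s, t], continuous f}.
    move=> x; apply: continuousB.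
      apply: (within_continuous_shift cont1) => y /=; rewrite in_itv/= => /andP[sy yt].
      apply: inD; last by rewrite (le_trans _ tvb)// lerD2r.
      by rewrite (lt_le_trans as_)// (le_trans sy)// lerDl ltW.
    apply: (continuous_subspaceW _ cont1) => y /=; rewrite in_itv/= => /andP[sy yt].
    apply: inD; first exact: lt_le_trans sy.
    by rewrite (le_trans yt)// (le_trans _ tvb)// lerDl ltW.
  have [xi] := MVT st fdf cf; rewrite in_itv/= => /andP[sxi xit] E1.
  have xixv : xi < xi + v by rewrite ltrDl.
  have axi : a < xi by exact: lt_trans sxi.
  have xivb : xi + v < b by rewrite (lt_le_trans _ tvb)// ltrD2r.
  have fdf2 x : x \in `]xi, xi + v[%R ->
      is_derive x 1 (derive_in D gamma) (derive_in D (derive_in D gamma) x).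
    rewrite in_itv/= => /andP[xix xxv].
    have ax : a < x by exact: lt_trans xix.
    have xb : x < b by exact: lt_trans xivb.
    exact: derivable_in_is_derive D2 (inD _ ax (ltW xb)) (nD _ ax xb).
  have cf2 : {within `[xi, xi + v], continuous (derive_in D gamma)}.
    apply: (continuous_subspaceW _ cont2) => y /=; rewrite in_itv/= => /andP[sy yt].
    by apply: inD; [exact: lt_le_trans sy|exact: le_trans (ltW xivb)].
  have [eta] := MVT xixv fdf2 cf2.
  rewrite in_itv/= => /andP[xieta etaxv] E2.
  rewrite (_ : xi + v - xi = v) in E2; last by ring.
  have st0 : 0 < t - s by rewrite subr_gt0.
  rewrite -/(f t) -/(f s) E1 /df E2 !normrM (gtr0_norm v0) (gtr0_norm st0).
  rewrite !ler_wpM2r ?(ltW v0) ?(ltW st0)//.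
  apply: kab; first exact: lt_trans xieta.
  by rewrite ltW// (lt_trans etaxv).
have core2 v s t : 0 < v -> a < s -> s + v <= b -> a < t -> t + v <= b ->
    ka * v * `|s - t| <= `|gamma (s + v) - gamma s - (gamma (t + v) - gamma t)|.
  move=> v0 as_ svb at_ tvb; have [st|ts|->] := ltgtP s t.
  - by rewrite distrC (distrC (_ - gamma s)) gtr0_norm ?subr_gt0// core.
  - by rewrite gtr0_norm ?subr_gt0// core.
  - by rewrite !subrr normr0 mulr0.
move=> v s t /=; rewrite !in_itv/= => /andP[as_ sb] /andP[asv svb] /andP[at_ tb] /andP[atv tvb].
have [v0|v0|->] := ltgtP v 0.
(* A negative step is a positive one taken backwards: start from s + v and t + v and move by - v. *)
- have nv0 : 0 < - v by rewrite oppr_gt0.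
  have := @core2 (- v) (s + v) (t + v) nv0 asv _ atv; rewrite !addrK => /(_ sb tb).
  rewrite (ltr0_norm v0) opprD addrACA subrr addr0 => /le_trans; apply.
  rewrite -normrN le_eqVlt; apply/orP; left; apply/eqP; congr (`|_|); ring.
- by rewrite gtr0_norm// core2.
- by rewrite normr0 mulr0 mul0r normr_ge0.
Qed.

Lemma nondecreasing_lim0_ge0 (R : realType) (gamma : R -> R) :
  {in `]0, 1]%classic &, {homo gamma : s t / s <= t}} ->
  gamma t @[t --> 0^'+] --> 0 -> forall t, 0 < t <= 1 -> 0 <= gamma t.
Proof.
move=> mono lim0 t /andP[t0 t1]; rewrite leNgt; apply/negP => gt0.
have e0 : 0 < - gamma t by rewrite oppr_gt0.
have /cvgrPdist_lt/(_ _ e0) near0 := lim0.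
have ev : \forall s \near (0 : R)^'+, gamma t < gamma s /\ (0 < s < t).
  near=> s; split.
    have : `|0 - gamma s| < - gamma t by near: s; exact: near0.
    by rewrite sub0r normrN ltr_norml opprK => /andP[].
  apply/andP; split; first by near: s; exact: nbhs_right_gt.
  by near: s; exact: nbhs_right_lt.
have [s [gs /andP[s0 st]]] := @filter_ex _ (0 : R)^'+ _ _ ev.
move: gs; rewrite ltNge => /negP; apply.
apply: mono; rewrite ?inE/= ?in_itv/= ?t0 ?t1 ?s0 ?(ltW st)//.
by rewrite (le_trans (ltW st)).
Unshelve. all: by end_near. Qed.

(** The limit 0 at the origin fixes the sign of gamma, so both kinds of monotonicity make |gamma|
    nondecreasing; the nonincreasing case follows by passing to - gamma. *)
Lemma monotonic_abs_le (R : realType) (gamma : R -> R) :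
  monotonic_in `]0, 1]%classic gamma -> gamma t @[t --> 0^'+] --> 0 ->
  forall s t, 0 < s -> s <= t -> t <= 1 -> `|gamma s| <= `|gamma t|.
Proof.
move=> mono lim0 s t s0 st t1.
have Ds : s \in (`]0, 1]%classic : set R) by rewrite inE/= in_itv/= s0 (le_trans st).
have Dt : t \in (`]0, 1]%classic : set R) by rewrite inE/= in_itv/= t1 (lt_le_trans s0).
have s1 : 0 < s <= 1 by rewrite s0 (le_trans st).
have t1' : 0 < t <= 1 by rewrite (lt_le_trans s0).
case: mono => mono.
  have g0 := nondecreasing_lim0_ge0 mono lim0.
  by rewrite !ger0_norm ?g0// mono.
have mono' : {in `]0, 1]%classic &, {homo (fun x => - gamma x) : s t / s <= t}}.
  by move=> x y xD yD xy; rewrite lerN2; exact: mono.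
have lim0' : (- gamma t) @[t --> (0 : R)^'+] --> (0 : R).
  apply/cvgrPdist_lt => e e0; move/cvgrPdist_lt : lim0 => /(_ e e0).
  by apply: filterS => x; rewrite !sub0r opprK normrN.
have g0 := nondecreasing_lim0_ge0 mono' lim0'.
by rewrite -[gamma s]opprK -[gamma t]opprK normrN (normrN (- _)) !ger0_norm ?g0// lerN2 mono.
Qed.

(** Nothing is known of gamma outside ]0, 1]. Its extension by 0 is measurable on the whole line and
    gives the same integrals over ]0, 1]. *)
Lemma measurable_patch_gamma (R : realType) (gamma : R -> R) :
  derivable_in `]0, 1]%classic gamma ->
  measurable_fun setT (gamma \_ `]0, 1]%classic).
Proof.
move=> D1; have mD := @measurable_itv R `]0, 1].
apply/(measurable_restrictT _ mD).
apply: subspace_continuous_measurable_fun; first exact: measurable_itv.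
exact: derivable_in_continuous.
Qed.

(** Hypothesis (i) for j = 2, made uniform on ]a, b]: the quantity c |gamma t| / t ^ 2 is at least
    its value with |gamma| taken at the left end and t at the right end, as |gamma| is
    nondecreasing. *)
Definition curvature_lower (R : realType) (gamma : R -> R) (c : R) :=
  forall a b, 0 < a -> b <= 1 ->
  curved_on `]a, b]%classic (c * `|gamma a| / b ^+ 2) gamma.

Lemma gamma_curvature (R : realType) (gamma : R -> R) :
  Cn_in `]0, 1]%classic 2 gamma ->
  monotonic_in `]0, 1]%classic gamma -> gamma t @[t --> 0^'+] --> 0 ->
  (forall t, t \in `]0, 1]%classic -> gamma t != 0) ->
  (exists2 C : R, 0 < C & forall t, t \in `]0, 1]%classic ->
       C <= `|t ^+ 2 * deriven_in `]0, 1]%classic 2 gamma t / gamma t|) ->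
  exists2 c : R, 0 < c & curvature_lower gamma c.
Proof.
move=> [gC2 _] mono lim0 gN0 [c c0 Hc]; exists c => // a b a0 b1.
apply: second_difference_bound => //; first exact: ltW.
- by rewrite !mulr_ge0 ?invr_ge0 ?sqr_ge0 ?(ltW c0).
- exact: (gC2 0%N).
- exact: (gC2 1%N).
move=> t at_ tb.
have t0 : 0 < t by exact: lt_trans at_.
have b0 : 0 < b by exact: lt_le_trans tb.
have Dt : t \in (`]0, 1]%classic : set R) by rewrite inE/= in_itv/= t0 (le_trans tb).
have gt0 : 0 < `|gamma t| by rewrite normr_gt0 gN0.
have := Hc t Dt; rewrite normrM normfV ler_pdivlMr// normrM normrX (gtr0_norm t0) => Ht.
rewrite ler_pdivrMr ?exprn_gt0//.
apply: (@le_trans _ _ (c * `|gamma t|)).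
  rewrite ler_wpM2l ?(ltW c0)//; apply: monotonic_abs_le => //; first exact: ltW.
  exact: le_trans b1.
apply: (le_trans Ht); by rewrite mulrC ler_wpM2l// ler_sqr ?nnegrE ?(ltW t0) ?(ltW b0).
Qed.

(** * Summation over dyadic pieces *)

Definition dyadic_piece (R : realType) (j : nat) : set (measurableTypeR R) :=
  `](2^-1 ^+ j.+1), (2^-1 ^+ j)]%classic.

Lemma half_expr_bounds (R : realType) (j : nat) :
  (0 < (2^-1 : R) ^+ j) * ((2^-1 : R) ^+ j <= 1).
Proof.
split; first by rewrite exprn_gt0// invr_gt0.
by rewrite exprn_ile1// ?invr_ge0// invf_le1// ler1n.
Qed.

Lemma dyadic_piece_sub (R : realType) (j : nat) :
  @dyadic_piece R j `<=` (`]0, 1]%classic : set R).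
Proof.
move=> t; rewrite /dyadic_piece/= !in_itv/= => /andP[t1 t2].
have [h0 _] := @half_expr_bounds R j.+1; have [_ h1] := @half_expr_bounds R j.
by rewrite (lt_trans h0 t1) (le_trans t2).
Qed.

Lemma measurable_dyadic_piece (R : realType) (j : nat) :
  measurable (@dyadic_piece R j).
Proof. exact: (@measurable_itv R). Qed.

(** The true length is half of this bound. Keeping 2 ^ (- j) lets one number serve both as bound on
    the length and as right end in [curvature_lower]. *)
Lemma lebesgue_dyadic_piece (R : realType) (j : nat) :
  (lebesgue_measure (@dyadic_piece R j) <= (2^-1 ^+ j)%:E)%E.
Proof.
have [h0 _] := @half_expr_bounds R j.+1; have [h1 _] := @half_expr_bounds R j.
rewrite lebesgue_measure_itv/= lte_fin; case: ifP => _; rewrite lee_fin ?ltW//.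
by rewrite ltrBlDr ltrDl.
Qed.

Lemma curved_onS (R : realType) (A : set R) (ka : R) (f g : R -> R) :
  (forall t, A t -> f t = g t) -> curved_on A ka f -> curved_on A ka g.
Proof.
by move=> fg cf v s t As Asv At Atv; rewrite -!fg//; exact: cf.
Qed.

(** The energy constant of the piece is k = dl ^ 2 / (c |gamma a|), a being its left end. Inserted
    into dl ^ (q - 3 th) k ^ th it leaves dl ^ (q - th) |gamma a| ^ (- th), up to a power of c. *)
Lemma dyadic_piece_bound (R : realType) (gamma : R -> R) (c p q : R) :
  derivable_in `]0, 1]%classic gamma -> 0 < c -> curvature_lower gamma c ->
  (forall t, t \in `]0, 1]%classic -> gamma t != 0) ->
  1 <= p -> p <= q -> q <= 2 * p -> 2 / p - 1 <= q^-1 ->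
  exists2 C : R, 0 < C &
  forall (g : plane R -> R) (u P : R) (j : nat), 1 <= u ->
  measurable_fun setT g -> (forall x, 0 <= g x) -> 0 <= P ->
  (\int[lebesgue_measure \x lebesgue_measure]_x (g x `^ p)%:E <= P%:E)%E ->
  (\int[lebesgue_measure \x lebesgue_measure]_x
     (\int[lebesgue_measure]_(t in @dyadic_piece R j)
        (g ((x.1 - u * t)%R, (x.2 - u * gamma t)%R))%:E) `^ q
   <= (C * (2^-1 ^+ j) `^ (q - (q / p - 1)) *
        `|gamma (2^-1 ^+ j.+1)| `^ (- (q / p - 1)) * P `^ (q / p))%:E)%E.
Proof.
move=> D1 c0 gc gN0 p1 pq q2p pq1.
have [C C0 HC] := strong_type_triangle p1 pq q2p pq1.
exists (C * c `^ (- (q / p - 1))); first by rewrite mulr_gt0// powR_gt0.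
move=> g u P j u1 mg g0 P0 gP; pose mR := measurableTypeR R.
set th := q / p - 1; set dl := 2^-1 ^+ j; set a := 2^-1 ^+ j.+1.
have [dl0 dl1] := @half_expr_bounds R j; rewrite -/dl in dl0 dl1.
have [a0 _] := @half_expr_bounds R j.+1; rewrite -/a in a0.
have aD : a \in (`]0, 1]%classic : set R).
  by rewrite inE/= in_itv/= a0 /a; have [_ ->] := @half_expr_bounds R j.+1.
have ga0 : 0 < `|gamma a| by rewrite normr_gt0 gN0.
pose gam := gamma \_ `]0, 1]%classic.
have mgam : measurable_fun setT gam by exact: measurable_patch_gamma.
have gamE t : @dyadic_piece R j t -> gamma t = gam t.
  by move=> /dyadic_piece_sub Dt; rewrite /gam patchE mem_set.
pose ka := c * `|gamma a| / dl ^+ 2.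
have ka0 : 0 < ka by rewrite divr_gt0 ?exprn_gt0// mulr_gt0.
have cur : curved_on (@dyadic_piece R j) ka gam.
  by apply: (curved_onS gamE); exact: gc.
have mJ := @measurable_dyadic_piece R j.
have Joo : (lebesgue_measure (@dyadic_piece R j) < +oo)%E.
  exact: le_lt_trans (@lebesgue_dyadic_piece R j) (ltry _).
pose m : {finite_measure set mR -> \bar R} := mfrestr mJ Joo.
have mL A : measurable A -> (m A <= lebesgue_measure A)%E.
  by move=> mA; rewrite /m /= /mfrestr /mrestr le_measure ?inE//; exact: measurableI.
have mdl : (m setT <= dl%:E)%E.
  by rewrite /m /= /mfrestr /mrestr setTI; exact: @lebesgue_dyadic_piece.
have mc1 : measurable_fun setT (fun t : R => u * t) by meas.
have mc2 : measurable_fun setT (fun t : R => u * gam t) by meas.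
have En : energy_bound m (fun t => u * t) (fun t => u * gam t) ka^-1.
  exact: (energy_bound_curve mJ mgam ka0 u1 cur).
have kai0 : 0 < ka^-1 by rewrite invr_gt0.
have := HC m _ _ g _ dl P mL mdl dl0 mc1 mc2 mg g0 kai0 En P0 gP.
rewrite (eq_integral (fun x : plane R => (\int[lebesgue_measure]_(t in @dyadic_piece R j)
        (g ((x.1 - u * t)%R, (x.2 - u * gamma t)%R))%:E) `^ q)%E); last first.
  move=> x _; congr (_ `^ _)%E.
  have mgam' : measurable_fun (setT : set mR) gam := mgam.
  have mf : measurable_fun setT (fun t : mR => (g (x.1 - u * t, x.2 - u * gam t))%:E).
    by meas.
  transitivity (\int[mrestr lebesgue_measure mJ]_t (g (x.1 - u * t, x.2 - u * gam t)%R)%:E)%E => //.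
  rewrite ge0_integral_mrestr//; last by move=> t; rewrite lee_fin.
  rewrite [RHS]integral_mkcond; apply: eq_integral => t _.
  rewrite patchE indicE; case: ifPn => [|_]; last by rewrite mul0e.
  by rewrite inE => Jt; rewrite mul1e (gamE t Jt).
move=> /le_trans; apply; rewrite lee_fin le_eqVlt; apply/orP; left; apply/eqP.
rewrite -/th /ka invfM invrK powRM ?invr_ge0 ?mulr_ge0 ?exprn_ge0 ?(ltW c0) ?(ltW dl0)//.
rewrite invfM powRM ?invr_ge0 ?(ltW c0)//.
rewrite -(powR_inv1 (ltW c0)) -(powR_inv1 (ltW ga0)) -!powRrM !mulN1r.
rewrite -powR_mulrn ?(ltW dl0)// -powRrM.
have -> : q - th = (q - 3 * th) + 2 * th by lra.
rewrite (powRD (r := q - 3 * th)) ?(gt_eqF dl0) ?implybT//; ring.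
Qed.

Lemma geometric_sum_le (R : realType) (s : R) (n : nat) : 0 <= s -> s < 1 ->
  \sum_(0 <= i < n) s ^+ i <= (1 - s)^-1.
Proof.
move=> s0 s1; have s10 : 0 < 1 - s by rewrite subr_gt0.
have E : (\sum_(0 <= i < n) s ^+ i) * (1 - s) = 1 - s ^+ n.
  elim: n => [|n IH]; first by rewrite big_geq// mul0r expr0 subrr.
  by rewrite big_nat_recr//= mulrDl IH exprS; ring.
by rewrite -[leRHS]mul1r ler_pdivlMr// E gerBl exprn_ge0.
Qed.

Lemma geometric_nneseries_le (R : realType) (s : R) (a : nat -> \bar R)
    (M : \bar R) : 0 <= s -> s < 1 -> (0 <= M)%E -> (forall j, 0 <= a j)%E ->
  (forall j, a j <= (s ^+ j)%:E * M)%E ->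
  (\sum_(0 <= j <oo) a j <= (1 - s)^-1%:E * M)%E.
Proof.
move=> s0 s1 M0 a0 aM; apply: lime_le; first exact: is_cvg_nneseries.
apply: nearW => n; apply: (@le_trans _ _ (\sum_(0 <= j < n) (s ^+ j)%:E * M)%E).
  by apply: lee_sum => j _; exact: aM.
rewrite -ge0_sume_distrl; last by move=> j _; rewrite lee_fin exprn_ge0.
by rewrite sumEFin lee_wpmul2r// lee_fin geometric_sum_le.
Qed.

(** A substitute for the triangle inequality in L^q with infinitely many terms. Each term of the
    weighted series is at most its sum S, so a_j <= s ^ j S ^ (1/q), and the geometric series is
    summed. The weights are paid for by the decay of the pieces. *)
Lemma power_nneseries_le (R : realType) (s q : R) (a : nat -> \bar R) :
  0 < s -> s < 1 -> 0 < q -> (forall j, 0 <= a j)%E ->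
  ((\sum_(0 <= j <oo) a j) `^ q <=
    ((1 - s)^-1 `^ q)%:E * \sum_(0 <= j <oo) (((s ^+ j) `^ (- q))%:E * a j `^ q))%E.
Proof.
move=> s0 s1 q0 a0; set S := (\sum_(0 <= j <oo) (_ * _))%E.
have t0 j : (0 <= ((s ^+ j) `^ (- q))%:E * a j `^ q)%E.
  by rewrite mule_ge0 ?lee_fin ?powR_ge0 ?poweR_ge0.
have S0 : (0 <= S)%E by exact: nneseries_ge0.
have tS j : (((s ^+ j) `^ (- q))%:E * a j `^ q <= S)%E.
  apply: le_trans (nneseries_lim_ge j.+1 _); last by move=> n _ _; exact: t0.
  by rewrite big_nat_recr//= leeDr// sume_ge0.
have aS j : (a j <= (s ^+ j)%:E * S `^ q^-1)%E.
  have sj0 : 0 < s ^+ j by rewrite exprn_gt0.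
  have sjq : 0 < (s ^+ j) `^ q by rewrite powR_gt0.
  have -> : ((s ^+ j)%:E * S `^ q^-1 = (((s ^+ j) `^ q)%:E * S) `^ q^-1)%E.
    rewrite poweRM// ?lee_fin ?powR_ge0// poweR_EFin -powRrM divff ?gt_eqF//.
    by rewrite powRr1// ltW.
  rewrite -[leLHS](@poweRK _ _ q) ?gt_eqF//.
  apply: le_poweR; rewrite ?invr_ge0 ?(ltW q0) ?poweR_ge0//.
  by rewrite -lee_pdivrMl// -powRN.
have := geometric_nneseries_le (ltW s0) s1 (poweR_ge0 S q^-1) a0 aS.
have A0 : (0 <= \sum_(0 <= j <oo) a j)%E by exact: nneseries_ge0.
move=> /(le_poweR (ltW q0) A0) /le_trans; apply.
have s10 : 0 <= (1 - s)^-1 by rewrite invr_ge0 subr_ge0 ltW.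
by rewrite poweRM ?poweR_ge0// -poweRrM mulVf ?gt_eqF// poweRe1.
Qed.

Lemma bigcup_dyadic_piece (R : realType) :
  \bigcup_j (@dyadic_piece R j) = (`]0, 1]%classic : set R).
Proof.
apply/seteqP; split=> [t [j _ /dyadic_piece_sub//]|t]; rewrite /= in_itv/= => /andP[t0 t1].
have ex : exists n, (2^-1 : R) ^+ n < t.
  exists (Num.bound t^-1); rewrite exprVn -[ltRHS]invrK ltf_pV2 ?posrE ?exprn_gt0 ?invr_gt0//.
  apply: lt_trans (archi_boundP _) _; first by rewrite invr_ge0 ltW.
  by rewrite -natrX ltr_nat ltn_expl.
case: (ex_minnP ex) => -[|n] nt mn.
  by move: nt; rewrite expr0 ltNge t1.
exists n => //; rewrite /dyadic_piece/= in_itv/= nt/= leNgt; apply/negP => /mn.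
by rewrite ltnn.
Qed.

Lemma trivIset_dyadic_piece (R : realType) :
  trivIset setT (@dyadic_piece R).
Proof.
have key i j t : (i < j)%N -> @dyadic_piece R i t -> @dyadic_piece R j t -> False.
  move=> ij; rewrite /dyadic_piece/= !in_itv/= => /andP[ti _] /andP[_ tj].
  have := lt_le_trans ti tj; rewrite ltNge => /negP; apply.
  by rewrite ler_wiXn2l ?invr_ge0// invf_le1// ler1n.
move=> i j _ _ [t [ti tj]]; have [ij|ji|//] := ltngtP i j.
- by have := key _ _ _ ij ti tj.
- by have := key _ _ _ ji tj ti.
Qed.

Lemma dyadic_sum_bound (R : realType) (gamma : R -> R) (c p q e B : R) :
  derivable_in `]0, 1]%classic gamma -> 0 < c -> curvature_lower gamma c ->
  (forall t, t \in `]0, 1]%classic -> gamma t != 0) ->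
  1 <= p -> p <= q -> q <= 2 * p -> 2 / p - 1 <= q^-1 ->
  0 < e -> 0 <= B ->
  (forall j, (2^-1 ^+ j) `^ (q - (q / p - 1)) *
     `|gamma (2^-1 ^+ j.+1)| `^ (- (q / p - 1)) <= B * (2^-1 ^+ j) `^ e) ->
  exists2 K : R, 0 <= K &
  forall (g : plane R -> R) (u P : R), 1 <= u ->
  measurable_fun setT g -> (forall x, 0 <= g x) -> 0 <= P ->
  (\int[lebesgue_measure \x lebesgue_measure]_x (g x `^ p)%:E <= P%:E)%E ->
  (\int[lebesgue_measure \x lebesgue_measure]_x
     (\int[lebesgue_measure]_(t in `]0%R, 1%R])
        (g ((x.1 - u * t)%R, (x.2 - u * gamma t)%R))%:E) `^ q
   <= (K * P `^ (q / p))%:E)%E.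
Proof.
move=> D1 c0 gc gN0 p1 pq q2p pq1 e0 B0 HB; pose mR := measurableTypeR R.
have q0 : 0 < q by rewrite (lt_le_trans _ pq)// (lt_le_trans _ p1).
have [C C0 HC] := dyadic_piece_bound D1 c0 gc gN0 p1 pq q2p pq1.
(* Half of the decay 2 ^ (- j e) pays for the weights s ^ (- j q) = 2 ^ (j e / 2); the other half is
   r ^ j and is summable. *)
pose s := (2^-1 : R) `^ (e / (2 * q)); pose r := (2^-1 : R) `^ (e / 2).
have h0 : 0 < (2^-1 : R) by rewrite invr_gt0.
have h1 : 0 < (2^-1 : R) < 1 by rewrite h0 invf_lt1// ltr1n.
have powlt1 (x : R) : 0 < x -> (2^-1 : R) `^ x < 1.
  move=> x0; have := gt0_ltr_powR x0; move=> /(_ 2^-1 1); rewrite powR1; apply.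
  - by rewrite nnegrE ltW.
  - by rewrite nnegrE.
  - by have /andP[] := h1.
have s0 : 0 < s by rewrite powR_gt0.
have s1 : s < 1 by rewrite powlt1// divr_gt0// mulr_gt0.
have r0 : 0 < r by rewrite powR_gt0.
have r1 : r < 1 by rewrite powlt1// divr_gt0.
exists ((1 - s)^-1 `^ q * ((1 - r)^-1 * (C * B))).
  by rewrite !mulr_ge0 ?powR_ge0 ?invr_ge0 ?subr_ge0 ?(ltW r1) ?(ltW C0).
move=> g u P u1 mg g0 P0 gP.
pose gam := gamma \_ `]0, 1]%classic.
have mgam : measurable_fun (setT : set mR) gam by exact: measurable_patch_gamma.
pose Fx (x : plane R) (t : mR) := (g (x.1 - u * t, x.2 - u * gam t))%:E.
have FxE x (A : set mR) : measurable A -> A `<=` (`]0, 1]%classic : set R) ->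
    (\int[lebesgue_measure]_(t in A) (g ((x.1 - u * t)%R, (x.2 - u * gamma t)%R))%:E =
     \int[lebesgue_measure]_(t in A) Fx x t)%E.
  move=> mA AD; apply: eq_integral => t; rewrite inE => At.
  by rewrite /Fx /gam patchE mem_set//; exact: AD.
have Fx0 x t : (0 <= Fx x t)%E by rewrite lee_fin.
have mFx x : measurable_fun setT (Fx x) by rewrite /Fx; meas.
pose a j x := (\int[lebesgue_measure]_(t in @dyadic_piece R j) Fx x t)%E.
have a0 j x : (0 <= a j x)%E by exact: integral_ge0.
have ma j : measurable_fun setT (a j).
  have mJ := @measurable_dyadic_piece R j.
  have mI : measurable_fun setT (\1_(@dyadic_piece R j) : mR -> R).
    exact: measurable_indic.
  have := @measurable_fun_fubini_tonelli_F _ _ (plane R) mR R lebesgue_measure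
    (fun w => (\1_(@dyadic_piece R j) w.2)%:E * Fx w.1 w.2)%E.
  have -> : fubini_F lebesgue_measure
      (fun w : plane R * mR => (\1_(@dyadic_piece R j) w.2)%:E * Fx w.1 w.2)%E = a j.
    apply/funext => x; rewrite /fubini_F /a [RHS]integral_mkcond.
    by apply: eq_integral => t _; rewrite patchE indicE/=; case: ifP; rewrite ?mul1e ?mul0e.
  apply; first by rewrite /Fx; meas.
  by move=> w; rewrite mule_ge0 ?lee_fin.
have TE x : (\int[lebesgue_measure]_(t in `]0%R, 1%R])
     (g ((x.1 - u * t)%R, (x.2 - u * gamma t)%R))%:E = \sum_(0 <= j <oo) a j x)%E.
  have mD : measurable (`]0, 1]%classic : set mR) by exact: (@measurable_itv R).
  rewrite (FxE x _ mD)//.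
  rewrite -bigcup_dyadic_piece ge0_integral_bigcup//.
  - by move=> j; exact: measurable_dyadic_piece.
  - exact: measurable_funTS (mFx x).
  - exact: trivIset_dyadic_piece.
have aC j : (\int[lebesgue_measure \x lebesgue_measure]_x (a j x `^ q) <=
    (C * B * (2^-1 ^+ j) `^ e * P `^ (q / p))%:E)%E.
  have := HC g u P j u1 mg g0 P0 gP.
  rewrite (eq_integral (fun x => a j x `^ q)%E); last first.
    move=> x _; rewrite FxE//; first exact: measurable_dyadic_piece.
    exact: dyadic_piece_sub.
  move=> /le_trans; apply; rewrite lee_fin ler_wpM2r ?powR_ge0//.
  by rewrite -!mulrA ler_wpM2l ?(ltW C0).
have w0 j x : (0 <= ((s ^+ j) `^ (- q))%:E * a j x `^ q)%E.
  by rewrite mule_ge0 ?lee_fin ?powR_ge0 ?poweR_ge0.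
have mw j : measurable_fun setT (fun x => ((s ^+ j) `^ (- q))%:E * a j x `^ q)%E.
  have maj := ma j; meas.
have msum : measurable_fun setT (fun x => \sum_(0 <= j <oo) (((s ^+ j) `^ (- q))%:E * a j x `^ q))%E.
  exact: ge0_emeasurable_sum.
have mS : measurable_fun setT (fun x => \sum_(0 <= j <oo) a j x)%E.
  exact: ge0_emeasurable_sum.
rewrite (eq_integral (fun x : plane R => (\sum_(0 <= j <oo) a j x) `^ q)%E); last first.
  by move=> x _; rewrite TE.
apply: (@le_trans _ _ (\int[lebesgue_measure \x lebesgue_measure]_x
   (((1 - s)^-1 `^ q)%:E * \sum_(0 <= j <oo) (((s ^+ j) `^ (- q))%:E * a j x `^ q)))%E).
  apply: ge0_le_integral => //.
  - by move=> x _; exact: poweR_ge0.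
  - by meas.
  - exact: measurable_funeM.
  - by move=> x _; apply: power_nneseries_le.
rewrite ge0_integralZl//; last 2 first.
- by move=> x _; exact: nneseries_ge0.
- by rewrite lee_fin powR_ge0.
rewrite -mulrA EFinM lee_wpmul2l ?lee_fin ?powR_ge0//.
rewrite integral_nneseries// -mulrA EFinM.
apply: geometric_nneseries_le; rewrite ?(ltW r0)//.
- by rewrite lee_fin !mulr_ge0 ?powR_ge0 ?(ltW C0).
- by move=> j; exact: integral_ge0.
move=> j; have maj := ma j.
rewrite ge0_integralZl//; last 3 first.
- by meas.
- by move=> x _; exact: poweR_ge0.
- by rewrite lee_fin powR_ge0.
apply: le_trans (lee_wpmul2l _ (aC j)) _; first by rewrite lee_fin powR_ge0.
rewrite -!EFinM lee_fin le_eqVlt; apply/orP; left; apply/eqP.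
have sE : (s ^+ j) `^ (- q) * (2^-1 ^+ j) `^ e = r ^+ j.
  rewrite /s /r -!powR_mulrn ?powR_ge0 ?(ltW h0)// -!powRrM.
  rewrite -powRD ?(gt_eqF h0) ?implybT//; congr (_ `^ _).
  by field; rewrite gt_eqF.
by rewrite -sE; ring.
Qed.

(** * Averages of signed functions and Lebesgue norms *)

Lemma avgE (R : realType) (gamma : R -> R) (f : plane R -> R) (u : R) (x : plane R) :
  avg gamma f u x = (\int[lebesgue_measure]_t
    (\1_(`]0, 1]%classic : set R) t *
      f ((x.1 - u * t)%R, (x.2 - u * (gamma \_ `]0, 1]%classic) t)%R))%:E)%E.
Proof.
rewrite /avg integral_mkcond; apply: eq_integral => t _.
rewrite patchE indicE; case: ifPn => tD; last by rewrite mul0r.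
by rewrite mul1r patchE tD.
Qed.

(** As [f] may change sign and need not be integrable along every curve, Tonelli's theorem is
    applied to the positive and negative parts separately; the integral is by definition the
    difference of the two. *)
Lemma measurable_avg (R : realType) (gamma : R -> R) (f : plane R -> R) (u : R) :
  derivable_in `]0, 1]%classic gamma -> measurable_fun setT f ->
  measurable_fun setT (avg gamma f u).
Proof.
move=> D1 mf; pose mR := measurableTypeR R.
have mgam : measurable_fun (setT : set mR) (gamma \_ `]0, 1]%classic).
  exact: measurable_patch_gamma.
have mI : measurable_fun setT (\1_(`]0, 1]%classic : set R) : mR -> R).
  by apply: measurable_indic; exact: (@measurable_itv R).
pose H (w : plane R * mR) : \bar R := (\1_(`]0, 1]%classic : set R) w.2 *
      f (w.1.1 - u * w.2, w.1.2 - u * (gamma \_ `]0, 1]%classic) w.2))%:E.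
have mH : measurable_fun setT H by rewrite /H; meas.
have mHp : measurable_fun setT (fun w => maxe (H w) 0) by exact: measurable_maxe.
have mHn : measurable_fun setT (fun w => maxe (- H w) 0)%E.
  by apply: measurable_maxe => //; exact: measurableT_comp.
have Hp0 w : (0 <= maxe (H w) 0)%E by rewrite le_max lexx orbT.
have Hn0 w : (0 <= maxe (- H w) 0)%E by rewrite le_max lexx orbT.
rewrite (_ : avg gamma f u = (fun x => fubini_F lebesgue_measure (fun w => maxe (H w) 0) x -
   fubini_F lebesgue_measure (fun w => maxe (- H w) 0)%E x)%E); last first.
  apply/funext => x; rewrite avgE integralE /fubini_F; congr (_ - _)%E.
    by apply: eq_integral => t _; rewrite funeposE.
  by apply: eq_integral => t _; rewrite funenegE.
apply: emeasurable_funB.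
  exact: (measurable_fun_fubini_tonelli_F _ mHp Hp0).
exact: (measurable_fun_fubini_tonelli_F _ mHn Hn0).
Qed.

Lemma abs_avg_le (R : realType) (gamma : R -> R) (f : plane R -> R) (u : R) (x : plane R) :
  derivable_in `]0, 1]%classic gamma -> measurable_fun setT f ->
  (`|avg gamma f u x| <= avg gamma (fun y => `|f y|%R) u x)%E.
Proof.
move=> D1 mf; pose mR := measurableTypeR R.
have mgam : measurable_fun (setT : set mR) (gamma \_ `]0, 1]%classic).
  exact: measurable_patch_gamma.
have mI : measurable_fun setT (\1_(`]0, 1]%classic : set R) : mR -> R).
  by apply: measurable_indic; exact: (@measurable_itv R).
rewrite !avgE; apply: le_trans (le_abse_integral _ _ _) _ => //; first by meas.
rewrite le_eqVlt; apply/orP; left; apply/eqP; apply: eq_integral => t _.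
by rewrite /= normrM indicE ger0_norm.
Qed.

(** The L^p to L^q estimate for nonnegative functions without roots: [P] stands for a finite bound
    on the p-th power of the norm. *)
Definition strong_power_bound (R : realType) (gamma : R -> R) (p q K : R) :=
  forall (g : plane R -> R) (u P : R), 1 <= u ->
  measurable_fun setT g -> (forall x, 0 <= g x) -> 0 <= P ->
  (\int[lebesgue_measure \x lebesgue_measure]_x (g x `^ p)%:E <= P%:E)%E ->
  (\int[lebesgue_measure \x lebesgue_measure]_x (avg gamma g u x) `^ q
    <= (K * P `^ (q / p))%:E)%E.

Lemma LfunW (R : realType) (p : \bar R) (f : plane R -> R) :
  f \in Lfun lebesgue2 p ->
  measurable_fun setT f /\ ('N[lebesgue2]_p[EFin \o f] < +oo)%E.
Proof. by move=> /andP[/set_mem mf /set_mem ff]; split. Qed.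

Lemma uniform_of_power_bound (R : realType) (gamma : R -> R) (p q K : R) :
  derivable_in `]0, 1]%classic gamma -> 0 < p -> 0 < q -> 0 <= K ->
  strong_power_bound gamma p q K -> uniform_Lp_Lq gamma p%:E q%:E.
Proof.
(* [K] may be 0, whereas the constant must be positive; hence the added 1. *)
move=> D1 p0 q0 K0 HK; exists (K `^ q^-1 + 1); first by rewrite ltr_wpDl ?powR_ge0.
move=> f /LfunW[mf ffin] u /andP[u1 u2].
pose g x := `|f x|; have mg : measurable_fun setT g by rewrite /g; meas.
have NE : ('N[lebesgue2]_p%:E[EFin \o f] `^ p =
    \int[lebesgue_measure \x lebesgue_measure]_x (g x `^ p)%:E)%E.
  by rewrite poweR_Lnorm ?gt_eqF.
set N := ('N[lebesgue2]_p%:E[EFin \o f])%E in ffin NE *.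
have N0 : (0 <= N)%E by exact: Lnorm_ge0.
have [n nE] : exists n, N = n%:E by exists (fine N); rewrite fineK// ge0_fin_numE.
rewrite nE in N0 NE *; rewrite lee_fin in N0.
have P0 : 0 <= n `^ p by rewrite powR_ge0.
have gP : (\int[lebesgue_measure \x lebesgue_measure]_x (g x `^ p)%:E <= (n `^ p)%:E)%E.
  by rewrite -NE.
have := HK g u _ u1 mg (fun x => normr_ge0 _) P0 gP => bound.
have mavg := measurable_avg u D1 mf.
have mavgg := measurable_avg u D1 mg.
have I0 : (0 <= \int[lebesgue2]_x `|avg gamma f u x| `^ q)%E.
  by apply: integral_ge0 => x _; exact: poweR_ge0.
have Ile : (\int[lebesgue2]_x `|avg gamma f u x| `^ q <= (K * (n `^ p) `^ (q / p))%:E)%E.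
  apply: le_trans bound; apply: ge0_le_integral => //.
  - by move=> x _; exact: poweR_ge0.
  - have mabs : measurable_fun setT (fun x => `|avg gamma f u x|)%E.
      exact: measurableT_comp.
    by meas.
  - by meas.
  by move=> x _; apply: le_poweR; rewrite ?(ltW q0) ?abse_ge0//; exact: abs_avg_le.
have qi0 : 0 <= q^-1 by rewrite invr_ge0 ltW.
rewrite unlock; apply: le_trans (le_poweR qi0 I0 Ile) _.
rewrite poweR_EFin lee_fin powRM ?powR_ge0//.
have -> : ((n `^ p) `^ (q / p)) `^ q^-1 = n.
  rewrite -!powRrM (_ : _ * _ = 1) ?powRr1//.
  by rewrite mulrCA mulrA divfK ?divff ?gt_eqF.
by rewrite ler_wpM2r// lerDl.
Qed.

(** * The exponent omega and sufficiency *)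

(** Near 0 the quotient of logarithms stays below [w], and since ln t < 0 this reads |gamma t| >= t
    ^ w. Away from 0, |gamma| is bounded below by monotonicity while t ^ w is bounded above. *)
Lemma omega_lt_power_lower (R : realType) (gamma : R -> R) (w : R) :
  monotonic_in `]0, 1]%classic gamma -> gamma t @[t --> 0^'+] --> 0 ->
  (forall t, t \in `]0, 1]%classic -> gamma t != 0) ->
  (omega gamma < w%:E)%E ->
  exists2 c : R, 0 < c & forall t, 0 < t -> t <= 1 -> c * t `^ w <= `|gamma t|.
Proof.
move=> mono lim0 gN0; rewrite /omega /limf_esup => /ereal_inf_lt[_ [V V0 <-] Vw].
have gpos t : 0 < t -> t <= 1 -> 0 < `|gamma t|.
  by move=> t0 t1; rewrite normr_gt0 gN0// inE/= in_itv/= t0.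
have [d d0 Hd] : \forall t \near (0 : R), 0 < t -> V t by [].
rewrite /= in d0; pose t1 := Num.min (d / 2) 2^-1.
have t10 : 0 < t1 by rewrite lt_min divr_gt0//= invr_gt0.
have t1h : t1 <= 2^-1 by rewrite ge_min lexx orbT.
have t1d : t1 < d by rewrite gt_min; apply/orP; left; rewrite ltr_pdivrMr//; lra.
have t11 : t1 <= 1 by lra.
have near0 t : 0 < t -> t <= t1 -> t `^ w <= `|gamma t|.
  move=> t0 tt1.
  have Vt : V t.
    by apply: Hd => //=; rewrite sub0r normrN gtr0_norm// (le_lt_trans tt1).
  have t_1 : t < 1 by lra.
  have lnt : ln t < 0 by rewrite ln_lt0// t0.
  have : (ln `|gamma t| / ln t)%:E \in [set (ln `|gamma x| / ln x)%:E | x in V].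
    by rewrite inE; exists t.
  rewrite inE => /ereal_sup_ubound /le_lt_trans /(_ Vw); rewrite lte_fin.
  rewrite ltr_ndivrMr// => /ltW lnle.
  rewrite /powR gt_eqF// -[leRHS]lnK ?posrE ?gpos ?(ltW t_1)//.
  by rewrite ler_expR.
have g1 := gpos _ t10 t11.
have D0 : 0 < 1 + t1 `^ w by rewrite ltr_pwDl// powR_ge0.
(* The denominator bounds t ^ w on [t1, 1] for either sign of [w]: by 1 if w >= 0, by t1 ^ w
   otherwise. *)
exists (Num.min 1 (`|gamma t1| / (1 + t1 `^ w))); first by rewrite lt_min ltr01 divr_gt0.
move=> t t0 tle1; have [tt1|t1t] := leP t t1.
  apply: le_trans (near0 t t0 tt1); rewrite -[leRHS]mul1r ler_wpM2r ?powR_ge0//.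
apply: (@le_trans _ _ (`|gamma t1|)); last by apply: monotonic_abs_le => //; exact: ltW.
have tw : t `^ w <= 1 + t1 `^ w.
  have [w0|w0] := leP 0 w.
    have : t `^ w <= 1.
      by rewrite -[leRHS](powRr0 t) ger_powR// t0.
    by have := powR_ge0 t1 w; lra.
  have : t `^ w <= t1 `^ w.
    rewrite -[w]opprK !(powRN _ (- w)) lef_pV2 ?posrE ?powR_gt0//.
    by rewrite ge0_ler_powR ?nnegrE ?(ltW t10) ?(ltW t0) ?(ltW t1t)// oppr_ge0 ltW.
  lra.
apply: (@le_trans _ _ (`|gamma t1| / (1 + t1 `^ w) * (1 + t1 `^ w))).
  by apply: ler_pM => //; rewrite ?powR_ge0 ?le_min ?ler01 ?divr_ge0 ?(ltW D0)// ge_min lexx orbT.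
by rewrite divfK ?gt_eqF.
Qed.

(** A strict inequality leaves room for a real [w] above [om]. For finite [om] the chosen [w] halves
    the positive quantity; [om = +oo] contradicts the hypothesis as r < 0; for [om = -oo] the value
    w = -1 makes the quantity 1. *)
Lemma omega_exponent (R : realType) (om : \bar R) (r : R) : r < 0 ->
  (0 < 1 + (1 + om) * r%:E)%E ->
  exists2 w : R, (om < w%:E)%E & 0 < 1 + (1 + w) * r.
Proof.
move=> r0; case: om => [om| |] H.
- have {}H : 0 < 1 + (1 + om) * r by rewrite -lte_fin.
  exists (om + (1 + (1 + om) * r) / (2 * - r)).
    by rewrite lte_fin ltrDl divr_gt0// mulr_gt0// oppr_gt0.
  rewrite (_ : 1 + _ = (1 + (1 + om) * r) / 2); last by field; rewrite lt_eqF.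
  by rewrite divr_gt0.
- move: H; rewrite addey// lt0_mulye ?lte_fin// addeNy//.
- by exists (-1); rewrite ?ltNyr// subrr mul0r addr0.
Qed.

(** On the diagonal p = q the power of |gamma| disappears, and [omega gamma] may be infinite there.
    Off the diagonal |gamma a| >= c a ^ w turns the constant of a piece into a power of 2 ^ (- j)
    with exponent q - th - w th, which is q times the positive quantity for [w]. *)
Lemma dyadic_decay (R : realType) (gamma : R -> R) (p q : R) :
  monotonic_in `]0, 1]%classic gamma -> gamma t @[t --> 0^'+] --> 0 ->
  (forall t, t \in `]0, 1]%classic -> gamma t != 0) ->
  1 <= p -> p <= q ->
  (0 < 1 + (1 + omega gamma) * (q^-1 - p^-1)%:E)%E ->
  exists2 eB : R * R, 0 < eB.1 /\ 0 <= eB.2 &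
  forall j, (2^-1 ^+ j) `^ (q - (q / p - 1)) *
     `|gamma (2^-1 ^+ j.+1)| `^ (- (q / p - 1)) <= eB.2 * (2^-1 ^+ j) `^ eB.1.
Proof.
move=> mono lim0 gN0 p1 pq cond.
have p0 : 0 < p by exact: lt_le_trans p1.
have q0 : 0 < q by exact: lt_le_trans pq.
have [pqe|pqN] := eqVneq p q.
  exists (q, 1); first by [].
  move=> j; rewrite -pqe divff ?gt_eqF// subrr subr0 oppr0 powRr0 mulr1 mul1r.
  exact: lexx.
have pltq : p < q by rewrite lt_neqAle pqN.
have r0 : q^-1 - p^-1 < 0 by rewrite subr_lt0 ltf_pV2 ?posrE.
have [w omw w0] := omega_exponent r0 cond.
have [c c0 Hc] := omega_lt_power_lower mono lim0 gN0 omw.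
set th := q / p - 1.
have th0 : 0 <= th by rewrite subr_ge0 ler_pdivlMr// mul1r.
exists (q * (1 + (1 + w) * (q^-1 - p^-1)), (c * 2^-1 `^ w) `^ (- th)).
  by split; rewrite /= ?mulr_gt0 ?powR_ge0.
move=> j /=; have [d0 _] := @half_expr_bounds R j.
have [a0 a1] := @half_expr_bounds R j.+1.
set dl := 2^-1 ^+ j in d0 *; set a := 2^-1 ^+ j.+1 in a0 a1 *.
have aE : a = 2^-1 * dl by rewrite /a exprS.
have h0 : 0 < (2^-1 : R) by rewrite invr_gt0.
have -> : q * (1 + (1 + w) * (q^-1 - p^-1)) = (q - th) + - (w * th).
  by rewrite /th; field; rewrite !gt_eqF.
rewrite (powRD (r := q - th)) ?(gt_eqF d0) ?implybT//.
rewrite mulrCA ler_wpM2l ?powR_ge0//.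
rewrite -mulrN powRrM -powRM ?mulr_ge0 ?powR_ge0 ?(ltW c0)//.
rewrite -mulrA -powRM ?(ltW h0) ?(ltW d0)// -aE !powRN.
have ga : 0 < `|gamma a| by rewrite normr_gt0 gN0// inE/= in_itv/= a0.
rewrite lef_pV2 ?posrE ?powR_gt0 ?mulr_gt0 ?powR_gt0//.
rewrite ge0_ler_powR ?nnegrE ?mulr_ge0 ?powR_ge0 ?(ltW c0)//.
exact: Hc.
Qed.

Lemma recip_EFin (R : realType) (p : R) : p != 0 -> recip p%:E = p^-1.
Proof. by move=> p0; rewrite /recip inver (negbTE p0). Qed.

Lemma recip_pinfty (R : realType) : recip (+oo%E : \bar R) = 0.
Proof. by rewrite /recip invey. Qed.

Lemma abs_avg_le_add (R : realType) (gamma : R -> R) (f : plane R -> R) (u : R)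
    (M : R) (h : plane R -> R) (x : plane R) :
  derivable_in `]0, 1]%classic gamma -> measurable_fun setT f ->
  measurable_fun setT h -> 0 <= M -> (forall y, 0 <= h y) ->
  (forall y, `|f y| <= M + h y) ->
  (`|avg gamma f u x| <= M%:E + avg gamma h u x)%E.
Proof.
move=> D1 mf mh M0 h0 fMh; pose mR := measurableTypeR R.
have mgam : measurable_fun (setT : set mR) (gamma \_ `]0, 1]%classic).
  exact: measurable_patch_gamma.
have mI : measurable_fun setT (\1_(`]0, 1]%classic : set R) : mR -> R).
  by apply: measurable_indic; exact: (@measurable_itv R).
apply: le_trans (abs_avg_le u x D1 mf) _; rewrite !avgE.
have I0 (t : mR) : 0 <= (\1_(`]0, 1]%classic : set R) t : R) by [].
have <- : (\int[lebesgue_measure]_t (M%:E * (\1_(`]0, 1]%classic : set R) t)%:E) = M%:E)%E.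
  rewrite ge0_integralZl//; last by meas.
  have mD : measurable (`]0, 1]%classic : set mR) by exact: (@measurable_itv R).
  rewrite (integral_indic lebesgue_measure measurableT mD) setIT.
  have E : lebesgue_measure (`]0, 1]%classic : set mR) = 1%E.
    by rewrite lebesgue_measure_itv/= lte_fin ltr01 -EFinB subr0.
  by rewrite [X in (_ * X)%E]E mule1.
have Mi0 (t : mR) : setT t -> (0 <= M%:E * (\1_(`]0, 1]%classic : set R) t)%:E)%E.
  by move=> _; rewrite mule_ge0 ?lee_fin.
have hi0 (t : mR) : setT t -> (0 <= (\1_(`]0, 1]%classic : set R) t *
    h (x.1 - u * t, x.2 - u * (gamma \_ `]0, 1]%classic) t)%R)%:E)%E.
  by move=> _; rewrite lee_fin mulr_ge0.
rewrite -(ge0_integralD lebesgue_measure measurableT Mi0 _ hi0); [|by meas|by meas].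
apply: ge0_le_integral => //; try by meas.
by move=> t _; rewrite -EFinM -EFinD lee_fin (mulrC M) -mulrDr ler_wpM2l.
Qed.

(** The norm with exponent [+oo] unfolds to a case distinction on this positivity. *)
Lemma lebesgue2_setT_gt0 (R : realType) : (0 < @lebesgue2 R setT)%E.
Proof.
pose I01 : set (measurableTypeR R) := `[0, 1]%classic.
have mI : measurable I01 by exact: (@measurable_itv R).
have E : lebesgue_measure I01 = 1%E.
  by rewrite /I01 lebesgue_measure_itv/= lte_fin ltr01 -EFinB subr0.
have E2 : @lebesgue2 R (I01 `*` I01) = 1%E.
  rewrite [LHS](product_measure1E lebesgue_measure lebesgue_measure mI mI).
  by rewrite [X in (X * _)%E]E [X in (_ * X)%E]E mule1.
apply: (@lt_le_trans _ _ (@lebesgue2 R (I01 `*` I01))); first by rewrite E2 lte01.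
by apply: le_measure; rewrite ?inE//; exact: measurableX.
Qed.

(* [f] is only essentially bounded; the [(1, 1)] bound shows that its excess on
   a null set averages to zero almost everywhere. *)
Lemma uniform_Linfty (R : realType) (gamma : R -> R) (K : R) :
  derivable_in `]0, 1]%classic gamma -> strong_power_bound gamma 1 1 K ->
  uniform_Lp_Lq gamma +oo%E +oo%E.
Proof.
move=> D1 HK; exists 1 => // f /LfunW[mf ffin] u /andP[u1 _].
have T0 := @lebesgue2_setT_gt0 R.
rewrite mul1e unlock T0; move: ffin; rewrite unlock T0.
set M := ess_sup _ _ => Moo.
have M0 : (0 <= M)%E by apply: ess_sup_gee => //; apply: nearW => x; exact: abse_ge0.
have [k kE] : exists k, M = k%:E by exists (fine M); rewrite fineK// ge0_fin_numE.
have k0 : 0 <= k by rewrite -lee_fin -kE.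
pose h (x : plane R) := if `|f x| <= k then 0 else `|f x|.
have mh : measurable_fun setT h by rewrite /h; meas.
have h0 x : 0 <= h x by rewrite /h; case: ifP.
have fkh x : `|f x| <= k + h x.
  by rewrite /h; case: ifP => [|_]; rewrite ?addr0// lerDr.
have hae : \forall x \ae @lebesgue2 R, h x = 0.
  have := @ess_sup_ge _ _ _ (@lebesgue2 R) (abse \o (EFin \o f)).
  rewrite -/M kE; apply: filterS => x /=; rewrite lee_fin => fk.
  by rewrite /h fk.
have mhe : measurable_fun setT (fun x => (h x `^ 1)%:E) by meas.
have Ih : (\int[lebesgue_measure \x lebesgue_measure]_x (h x `^ 1)%:E <= 0%:E)%E.
  rewrite (@ae_eq_integral _ _ _ lebesgue2 setT (cst 0%E))//; first by rewrite integral0.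
  by apply: filterS hae => x -> _; rewrite powRr1.
have := HK h u 0 u1 mh h0 (lexx 0) Ih.
rewrite divr1 powRr1// mulr0 => Iavg.
have mavg := measurable_avg u D1 mh.
have avg0 x : (0 <= avg gamma h u x)%E.
  by apply: integral_ge0 => t _; rewrite lee_fin.
have Iavg0 : (\int[lebesgue2]_x `|avg gamma h u x| = 0)%E.
  apply/eqP; rewrite eq_le; apply/andP; split; last exact: integral_ge0.
  apply: le_trans Iavg; rewrite le_eqVlt; apply/orP; left; apply/eqP.
  by apply: eq_integral => x _; rewrite gee0_abs// poweRe1.
have /ae_eq_integral_abs := Iavg0; move=> /(_ measurableT mavg) avgae.
apply/ess_supP; apply: filterS avgae => x /(_ I) /= ax.
have := abs_avg_le_add u x D1 mf mh k0 h0 fkh.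
by rewrite ax adde0 -/M kE.
Qed.

(** The triangle rules out a single infinite exponent: 1/q <= 1/p makes q infinite if p is, and
    1/(2p) <= 1/q gives the converse. The remaining point (0, 0) is derived from the finite case (1,
    1), where equal reciprocals make the omega condition read 0 < 1. *)
Lemma sufficiency (R : realType) (gamma : R -> R) (c : R) (p q : \bar R) :
  derivable_in `]0, 1]%classic gamma -> 0 < c -> curvature_lower gamma c ->
  monotonic_in `]0, 1]%classic gamma -> gamma t @[t --> 0^'+] --> 0 ->
  (forall t, t \in `]0, 1]%classic -> gamma t != 0) ->
  (1 <= p)%E -> (1 <= q)%E ->
  triangle (recip p, recip q) ->
  (0 < 1 + (1 + omega gamma) * (recip q - recip p)%:E)%E ->
  uniform_Lp_Lq gamma p q.
Proof.
move=> D1 c0 gc mono lim0 gN0 + + [/= tr1 tr2 tr3].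
have fin_case (a b : R) : 1 <= a -> 1 <= b -> a^-1 / 2 <= b^-1 -> b^-1 <= a^-1 ->
    2 * a^-1 - 1 <= b^-1 ->
    (0 < 1 + (1 + omega gamma) * (b^-1 - a^-1)%:E)%E ->
    exists2 K : R, 0 <= K & strong_power_bound gamma a b K.
  move=> a1 b1 t1 t2 t3 cond.
  have a0 : 0 < a by exact: lt_le_trans a1.
  have b0 : 0 < b by exact: lt_le_trans b1.
  have ab : a <= b by rewrite -lef_pV2 ?posrE.
  have b2a : b <= 2 * a by rewrite -lef_pV2 ?posrE ?mulr_gt0// invfM mulrC.
  have [[e B] [/= e0 B0] HB] := dyadic_decay mono lim0 gN0 a1 ab cond.
  exact: (dyadic_sum_bound D1 c0 gc gN0 a1 ab b2a t3 e0 B0 HB).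
case: p tr1 tr2 tr3 => [p| |] + + + p1; last by [].
- have p_1 : 1 <= p by rewrite -lee_fin.
  have p0 : 0 < p by exact: lt_le_trans p_1.
  rewrite recip_EFin ?gt_eqF//.
  case: q => [q| |] + + + q1; last by [].
    have q_1 : 1 <= q by rewrite -lee_fin.
    have q0 : 0 < q by exact: lt_le_trans q_1.
    rewrite recip_EFin ?gt_eqF// => t1 t2 t3 cond.
    have [K K0 HK] := fin_case p q p_1 q_1 t1 t2 t3 cond.
    exact: uniform_of_power_bound HK.
  rewrite recip_pinfty => t1; exfalso; move: t1; rewrite leNgt => /negP; apply.
  by rewrite divr_gt0// invr_gt0.
- rewrite recip_pinfty; case: q => [q| |] + + + q1; last by [].
    have q_1 : 1 <= q by rewrite -lee_fin.
    have q0 : 0 < q by exact: lt_le_trans q_1.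
    rewrite recip_EFin ?gt_eqF// => _ t2; exfalso; move: t2.
    by rewrite leNgt => /negP; apply; rewrite invr_gt0.
  move=> _ _ _ _.
  have [K K0 HK] : exists2 K : R, 0 <= K & strong_power_bound gamma 1 1 K.
    apply: fin_case; rewrite ?invr1 ?lexx//.
    - by clear; lra.
    - by rewrite subrr mule0 adde0 lte_fin.
  exact: uniform_Linfty HK.
Qed.

(** * Test functions *)

Lemma LfunI (R : realType) (p : \bar R) (f : plane R -> R) :
  measurable_fun setT f -> ('N[lebesgue2]_p[EFin \o f] < +oo)%E ->
  f \in Lfun lebesgue2 p.
Proof. by move=> mf ff; apply/andP; split; apply: mem_set. Qed.

Lemma Lnorm_indic_le (R : realType) (p : \bar R) (S : set (plane R)) (s : R) :
  measurable S -> (1 <= p)%E -> 0 <= s -> (lebesgue2 S <= s%:E)%E ->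
  ('N[lebesgue2]_p[EFin \o (\1_S : plane R -> R)] <= (s `^ recip p)%:E)%E.
Proof.
move=> mS + s0 Ss; case: p => [p| |] p1; last by [].
- have p_1 : 1 <= p by rewrite -lee_fin.
  have p0 : 0 < p by exact: lt_le_trans p_1.
  rewrite recip_EFin ?gt_eqF// unlock -poweR_EFin.
  apply: le_poweR; first by rewrite invr_ge0 ltW.
    by apply: integral_ge0 => x _; exact: poweR_ge0.
  rewrite (eq_integral (fun x => (\1_S x)%:E)); last first.
    move=> x _; rewrite /= indicE; case: (_ \in _).
      by rewrite normr1 powR1.
    by rewrite normr0 powR0// gt_eqF.
  by rewrite integral_indic// setIT.
(* The bound is s ^ 0 = 1 even for s = 0, by the convention 0 ^ 0 = 1. *)
- rewrite recip_pinfty powRr0 unlock lebesgue2_setT_gt0.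
  apply/ess_supP; apply: nearW => x /=.
  by rewrite indicE lee_fin; case: (_ \in _); rewrite ?normr1// normr0.
Qed.

(** Chebyshev's inequality. For q infinite, a set of positive measure cannot be contained in the
    null set where |F| exceeds its essential supremum. *)
Lemma Lnorm_ge_on (R : realType) (q : \bar R) (F : plane R -> \bar R)
    (B : set (plane R)) (h b : R) :
  measurable_fun setT F -> measurable B -> (1 <= q)%E -> 0 <= h -> 0 < b ->
  (b%:E <= lebesgue2 B)%E -> (forall x, B x -> h%:E <= `|F x|)%E ->
  ((h * b `^ recip q)%:E <= 'N[lebesgue2]_q[F])%E.
Proof.
move=> mF mB + h0 b0 bB hF; case: q => [q| |] q1; last by [].
- have q_1 : 1 <= q by rewrite -lee_fin.
  have q0 : 0 < q by exact: lt_le_trans q_1.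
  have b0' := ltW b0.
  rewrite recip_EFin ?gt_eqF// unlock.
  have -> : (h * b `^ q^-1)%:E = ((h `^ q * b)%:E `^ q^-1)%E.
    by rewrite poweR_EFin powRM ?powR_ge0// -powRrM divff ?gt_eqF// powRr1.
  apply: le_poweR; rewrite ?invr_ge0 ?(ltW q0)//.
    by rewrite lee_fin mulr_ge0 ?powR_ge0.
  have mabs : measurable_fun setT (fun x => `|F x|)%E by exact: measurableT_comp.
  apply: (@le_trans _ _ (\int[lebesgue2]_(x in B) `|F x| `^ q)%E); last first.
    apply: ge0_subset_integral => //; first by meas.
    by move=> x _; exact: poweR_ge0.
  apply: (@le_trans _ _ (\int[lebesgue2]_(x in B) (cst (h `^ q)%:E x))%E).
    rewrite integral_cst// EFinM lee_wpmul2l// lee_fin powR_ge0 //.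
  apply: ge0_le_integral => //.
  - by move=> x _; rewrite lee_fin powR_ge0.
  - by apply: measurable_funTS; meas.
  by move=> x Bx; rewrite -poweR_EFin; apply: le_poweR; rewrite ?(ltW q0)//; exact: hF.
- rewrite recip_pinfty powRr0 mulr1 unlock lebesgue2_setT_gt0.
  rewrite leNgt; apply/negP => ess.
  have := @ess_sup_ge _ _ _ (@lebesgue2 R) (abse \o F) => -[N [mN N0 HN]].
  have BN : B `<=` N.
    move=> x Bx; apply: HN => /= Fx.
    by have := lt_le_trans ess (hF x Bx); rewrite ltNge Fx.
  have : (lebesgue2 B <= lebesgue2 N)%E by apply: le_measure; rewrite ?inE.
  by rewrite N0 leNgt (lt_le_trans _ bB)// lte_fin.
Qed.

Lemma avg_indic_ge (R : realType) (gamma : R -> R) (S : set (plane R))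
    (x : plane R) (a h : R) :
  derivable_in `]0, 1]%classic gamma -> measurable S ->
  0 < a -> 0 <= h -> a + h <= 1 ->
  (forall t, a <= t <= a + h -> S (x.1 - t, x.2 - gamma t)) ->
  (h%:E <= `|avg gamma (\1_S : plane R -> R) 1 x|)%E.
Proof.
move=> D1 mS a0 h0 ah1 St; pose mR := measurableTypeR R.
have mgam : measurable_fun (setT : set mR) (gamma \_ `]0, 1]%classic).
  exact: measurable_patch_gamma.
have mI : measurable_fun setT (\1_(`]0, 1]%classic : set R) : mR -> R).
  by apply: measurable_indic; exact: (@measurable_itv R).
have mIS : measurable_fun setT (\1_S : plane R -> R) by exact: measurable_indic.
have I0 : (0 <= avg gamma (\1_S : plane R -> R) 1 x)%E.
  by apply: integral_ge0 => t _; rewrite lee_fin.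
rewrite gee0_abs// avgE.
pose A : set mR := `[a, a + h]%classic.
have mA : measurable A by exact: (@measurable_itv R).
have LA : lebesgue_measure A = h%:E.
  rewrite /A lebesgue_measure_itv/= lte_fin; case: ltP.
    by rewrite -EFinB addrAC subrr add0r.
  by rewrite gerDl => h0'; congr (_%:E); apply/eqP; rewrite eq_le h0 h0'.
rewrite -LA -[leLHS]mul1e -(integral_cst lebesgue_measure mA 1%E).
apply: (@le_trans _ _ (\int[lebesgue_measure]_(t in A)
   (\1_(`]0, 1]%classic : set R) t * (\1_S : plane R -> R)
     ((x.1 - 1 * t)%R, (x.2 - 1 * (gamma \_ `]0, 1]%classic) t)%R))%:E)%E); last first.
  by apply: ge0_subset_integral => //; meas.
rewrite le_eqVlt; apply/orP; left; apply/eqP; apply: eq_integral => t.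
rewrite inE /A/= in_itv/= => ta; have /andP[at_ tah] := ta.
have tD : t \in (`]0, 1]%classic : set R).
  by rewrite inE/= in_itv/= (lt_le_trans a0)// (le_trans tah).
by rewrite indicE tD !mul1r patchE tD indicE mem_set ?mul1r//; exact: St.
Qed.

(** What remains of the L^p to L^q estimate, with x = 1/p and y = 1/q, after testing at u = 1 on the
    indicator of [S], whose average is at least [h] on [B]. All necessary conditions are drawn from
    this numerical inequality. *)
Definition knapp_bound (R : realType) (gamma : R -> R) (x y C : R) :=
  forall (S B : set (plane R)) (s b h : R),
  measurable S -> measurable B -> 0 <= s -> 0 < b -> 0 <= h ->
  (lebesgue2 S <= s%:E)%E -> (b%:E <= lebesgue2 B)%E ->
  (forall x, B x -> exists2 a, 0 < a /\ a + h <= 1 &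
     forall t, a <= t <= a + h -> S (x.1 - t, x.2 - gamma t)) ->
  h * b `^ y <= C * s `^ x.

Lemma knapp_test (R : realType) (gamma : R -> R) (p q : \bar R) :
  derivable_in `]0, 1]%classic gamma -> (1 <= p)%E -> (1 <= q)%E ->
  uniform_Lp_Lq gamma p q ->
  exists2 C : R, 0 < C & knapp_bound gamma (recip p) (recip q) C.
Proof.
move=> D1 p1 q1 [C C0 HC]; exists C => // S B s b h mS mB s0 b0 h0 Ss bB HB.
have mIS : measurable_fun setT (\1_S : plane R -> R) by exact: measurable_indic.
have Np := Lnorm_indic_le mS p1 s0 Ss.
have fL : (\1_S : plane R -> R) \in Lfun lebesgue2 p.
  by apply: LfunI => //; exact: le_lt_trans Np (ltry _).
have u12 : ((1 : R) <= 1) && ((1 : R) <= 2) by lra.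
have := HC _ fL 1 u12.
have Bavg x : B x -> (h%:E <= `|avg gamma (\1_S : plane R -> R) 1 x|)%E.
  by move=> /HB[a [a0 ah1] St]; exact: (avg_indic_ge D1 mS a0 h0 ah1 St).
have mavg := measurable_avg 1 D1 mIS.
move=> /(le_trans (Lnorm_ge_on mavg mB q1 h0 b0 bB Bavg)) le1.
rewrite -lee_fin [leRHS]EFinM; apply: (le_trans le1).
by apply: lee_wpmul2l => //; rewrite lee_fin ltW.
Qed.

Lemma lebesgue_measure_cc (R : realType) (a b : R) : a <= b ->
  lebesgue_measure (`[a, b]%classic : set R) = (b - a)%:E.
Proof.
move=> ab; rewrite lebesgue_measure_itv/= lte_fin; case: ltP => [_|ba].
  by rewrite -EFinB.
by congr (_%:E); apply/esym/eqP; rewrite subr_eq0 eq_le ab ba.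
Qed.

Definition rectangle (R : realType) (a b c d : R) : set (plane R) :=
  (`[a, b]%classic : set (measurableTypeR R)) `*` `[c, d]%classic.

Lemma measurable_rectangle (R : realType) (a b c d : R) :
  measurable (rectangle a b c d).
Proof. by apply: measurableX; exact: (@measurable_itv R). Qed.

Lemma lebesgue2_rectangle (R : realType) (a b c d : R) : a <= b -> c <= d ->
  lebesgue2 (rectangle a b c d) = ((b - a) * (d - c))%:E.
Proof.
move=> ab cd.
have mab : measurable (`[a, b]%classic : set (measurableTypeR R)) by exact: (@measurable_itv R).
have mcd : measurable (`[c, d]%classic : set (measurableTypeR R)) by exact: (@measurable_itv R).
rewrite [LHS](product_measure1E lebesgue_measure lebesgue_measure mab mcd).
by rewrite [X in (X * _)%E](lebesgue_measure_cc ab) [X in (_ * X)%E](lebesgue_measure_cc cd).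
Qed.

Definition strip (R : realType) (phi : R -> R) (a b r : R) : set (plane R) :=
  [set x : plane R | (a <= x.1 <= b) && (`|x.2 - phi x.1| <= r)].

Lemma measurable_strip (R : realType) (phi : R -> R) (a b r : R) :
  measurable_fun setT phi -> measurable (strip phi a b r).
Proof.
move=> mphi.
have mb : measurable_fun setT (fun x : plane R =>
    (a <= x.1 <= b) && (`|x.2 - phi x.1| <= r)).
  apply: measurable_and; last by meas.
  by apply: measurable_and; meas.
rewrite (_ : strip phi a b r = setT `&` (fun x : plane R =>
    (a <= x.1 <= b) && (`|x.2 - phi x.1| <= r)) @^-1` [set true]).
  exact: mb.
by rewrite setTI; apply/seteqP; split=> x.
Qed.

Lemma lebesgue2_strip (R : realType) (phi : R -> R) (a b r : R) :
  measurable_fun setT phi -> a <= b -> 0 <= r ->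
  lebesgue2 (strip phi a b r) = (2 * r * (b - a))%:E.
Proof.
move=> mphi ab r0; pose mR := measurableTypeR R.
transitivity (\int[lebesgue_measure]_x
   ((2 * r)%:E * (\1_(`[a, b]%classic : set mR) x)%:E))%E.
  apply: eq_integral => x _ /=; rewrite indicE.
  have [xab|xab] := boolP (x \in (`[a, b]%classic : set mR)).
    rewrite mule1 (_ : xsection _ _ = (`[phi x - r, phi x + r]%classic : set R)).
      by rewrite lebesgue_measure_cc; [congr (_%:E); ring|lra].
    move: xab; rewrite inE/= in_itv/= => xab.
    rewrite /xsection; apply/seteqP; split=> y /=.
      by rewrite !inE/= /strip/= ?in_itv/= xab ler_distl.
    by rewrite !inE/= /strip/= ?in_itv/= xab ler_distl.
  rewrite mule0 (_ : xsection _ _ = set0) ?measure0//.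
  rewrite /xsection; apply/seteqP; split=> y //=; rewrite !inE/= /strip/=.
  by move=> /andP[xab' _]; move/negP: xab; apply; rewrite inE/= ?in_itv/=.
have mab : measurable (`[a, b]%classic : set mR) by exact: (@measurable_itv R).
rewrite ge0_integralZl//; last 2 first.
- by apply/measurable_EFinP; exact: measurable_indic.
- by rewrite lee_fin mulr_ge0.
rewrite (integral_indic lebesgue_measure measurableT mab) setIT.
by rewrite [X in (_ * X)%E](lebesgue_measure_cc ab).
Qed.

(** * Necessary conditions *)

(** A negative power blows up at 0. The bound is only asked at arbitrarily small d, because the
    upper limit defining omega provides no more than that. *)
Lemma power_bounded_frequently (R : realType) (e A : R) :
  (forall d0, 0 < d0 -> exists2 d, 0 < d <= d0 & d `^ e <= A) -> 0 <= e.
Proof.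
move=> HA; rewrite leNgt; apply/negP => e0.
have A1 : 0 < `|A| + 1 by rewrite ltr_pwDr.
have [|d /andP[d_0 dA] deA] := HA ((`|A| + 1) `^ e^-1); first by rewrite powR_gt0.
have ne0 : 0 <= - e by rewrite oppr_ge0 ltW.
have : `|A| + 1 <= d `^ e.
  have -> : `|A| + 1 = ((`|A| + 1) `^ e^-1) `^ e.
    by rewrite -powRrM mulVf ?lt_eqF// powRr1// ltW.
  rewrite -[e]opprK !(powRN _ (- e)) lef_pV2 ?posrE ?powR_gt0//.
  by rewrite ge0_ler_powR ?nnegrE ?(ltW d_0) ?powR_ge0// opprK.
by have := ler_norm A; lra.
Qed.

Lemma power_bounded_near0 (R : realType) (d0 e A : R) : 0 < d0 ->
  (forall d, 0 < d -> d <= d0 -> d `^ e <= A) -> 0 <= e.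
Proof.
move=> d00 HA; apply: power_bounded_frequently => d1 d10.
have d_0 : 0 < Num.min d0 d1 by rewrite lt_min d00.
exists (Num.min d0 d1); first by rewrite d_0 ge_min lexx orbT.
by apply: HA; rewrite // ge_min lexx.
Qed.

(** For t >= 1/2 the upper bound (ii) and |gamma t| <= |gamma 1| give a first derivative of size at
    most 2 C |gamma 1|. The arc over [1/2, 1] is all that the ball and neighbourhood tests need; the
    added 1 ensures L >= 1. *)
Lemma gamma_lipschitz (R : realType) (gamma : R -> R) :
  derivable_in `]0, 1]%classic gamma ->
  monotonic_in `]0, 1]%classic gamma -> gamma t @[t --> 0^'+] --> 0 ->
  (forall t, t \in `]0, 1]%classic -> gamma t != 0) ->
  (exists2 C : R, 0 < C & forall t, t \in `]0, 1]%classic ->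
       `|t * derive_in `]0, 1]%classic gamma t / gamma t| <= C) ->
  exists2 L : R, 1 <= L & forall s t, 2^-1 <= s <= 1 -> 2^-1 <= t <= 1 ->
    `|gamma s - gamma t| <= L * `|s - t|.
Proof.
move=> D1 mono lim0 gN0 [C C0 HC].
exists (1 + 2 * C * `|gamma 1|); first by rewrite lerDl !mulr_ge0 ?(ltW C0).
have core s t : 2^-1 <= s -> t <= 1 -> s < t ->
    `|gamma t - gamma s| <= 2 * C * `|gamma 1| * (t - s).
  move=> hs t1 st.
  have gd x : x \in `]s, t[%R -> is_derive x 1 gamma (derive_in `]0, 1]%classic gamma x).
    rewrite in_itv/= => /andP[sx xt].
    have x0 : 0 < x by lra.
    have x1 : x < 1 by lra.
    apply: derivable_in_is_derive => //; last exact: nbhs_half_open.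
    by rewrite /= in_itv/= x0 ltW.
  have gc : {within `[s, t], continuous gamma}.
    apply: (continuous_subspaceW _ (derivable_in_continuous D1)) => y /=.
    by rewrite !in_itv/= => /andP[sy yt]; apply/andP; split; lra.
  have [x] := MVT st gd gc; rewrite in_itv/= => /andP[sx xt] ->.
  have x0 : 0 < x by lra.
  have x1 : x <= 1 by lra.
  have xD : x \in (`]0, 1]%classic : set R) by rewrite inE/= in_itv/= x0.
  have gx0 : 0 < `|gamma x| by rewrite normr_gt0 gN0.
  have := HC x xD; rewrite normrM normfV ler_pdivrMr// normrM (gtr0_norm x0) => Hx.
  have st0 : 0 < t - s by lra.
  rewrite normrM (gtr0_norm st0) ler_wpM2r ?(ltW st0)//.
  have g1 : `|gamma x| <= `|gamma 1| by apply: monotonic_abs_le.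
  have C1 : C * `|gamma x| <= C * `|gamma 1| by rewrite ler_wpM2l ?(ltW C0).
  have D0 : 0 <= `|derive_in `]0, 1]%classic gamma x| by [].
  have : 2^-1 * `|derive_in `]0, 1]%classic gamma x| <= x * `|derive_in `]0, 1]%classic gamma x|.
    by rewrite ler_wpM2r//; lra.
  lra.
move=> s t /andP[s0 s1] /andP[t0 t1].
have ext d : 0 <= d -> 2 * C * `|gamma 1| * d <= (1 + 2 * C * `|gamma 1|) * d.
  by move=> d0; rewrite ler_wpM2r// lerDr.
have [st|ts|->] := ltgtP s t.
- rewrite distrC (distrC s) (gtr0_norm (_ : 0 < t - s)) ?subr_gt0//.
  by apply: le_trans (core s t s0 t1 st) _; apply: ext; rewrite subr_ge0 ltW.
- rewrite (gtr0_norm (_ : 0 < s - t)) ?subr_gt0//.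
  by apply: le_trans (core t s t0 s1 ts) _; apply: ext; rewrite subr_ge0 ltW.
- by rewrite !subrr normr0 mulr0.
Qed.

Lemma in_rectangle (R : realType) (a b c d : R) (z : plane R) :
  a <= z.1 -> z.1 <= b -> c <= z.2 -> z.2 <= d -> rectangle a b c d z.
Proof. by move=> z1 z2 z3 z4; split; rewrite /= in_itv/= ?z1 ?z3. Qed.

Lemma rectangle_in (R : realType) (a b c d : R) (z : plane R) :
  rectangle a b c d z -> (a <= z.1 <= b) * (c <= z.2 <= d).
Proof. by move=> []; rewrite /= !in_itv/=. Qed.

(* Test on a square of side [1/d], which averaging almost preserves. *)
Lemma knapp_large (R : realType) (gamma : R -> R) (x y C : R) :
  (forall s t, 0 < s -> s <= t -> t <= 1 -> `|gamma s| <= `|gamma t|) ->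
  knapp_bound gamma x y C -> 0 <= C -> y <= x.
Proof.
move=> mono HC C0; set M := `|gamma 1|; have M0 : 0 <= M by exact: normr_ge0.
(* For d <= d0 the side L = 1/d is at least 2 + 2 M, so the square enlarged by 1 + M on each side
   has side at most 2 L and area at most 4 L ^ 2. *)
rewrite -subr_ge0; pose d0 := (2 + 2 * M)^-1; have D0 : 0 < 2 + 2 * M by lra.
suff : 0 <= 2 * (x - y) by lra.
apply: (@power_bounded_near0 _ d0 _ (2 * C * 4 `^ x)); first by rewrite invr_gt0.
move=> d dpos dd0; pose L := d^-1.
have L0 : 0 < L by rewrite invr_gt0.
have LM : 2 + 2 * M <= L.
  by rewrite /L -[leLHS]invrK lef_pV2 ?posrE ?invr_gt0.
have := HC (rectangle (- (1 + M)) (L + 1 + M) (- (1 + M)) (L + 1 + M))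
  (rectangle 0 L 0 L) (4 * (L * L)) (L * L) 2^-1
  (measurable_rectangle _ _ _ _) (measurable_rectangle _ _ _ _).
rewrite !lebesgue2_rectangle ?(ltW L0)//; [|lra|lra].
rewrite !lee_fin !subr0 => H.
have LL0 : 0 < L * L by rewrite mulr_gt0.
have {}H : 2^-1 * (L * L) `^ y <= C * (4 * (L * L)) `^ x.
  apply: H => //; first by rewrite mulr_ge0// ltW.
  - have : (L + 1 + M) - - (1 + M) <= 2 * L by lra.
    by move=> LL; rewrite (_ : 4 * (L * L) = 2 * L * (2 * L)); [apply: ler_pM => //; lra|ring].
  move=> z /rectangle_in[/andP[z1 z2] /andP[z3 z4]]; exists 2^-1.
    by split; rewrite ?invr_gt0//; lra.
  move=> t /andP[t1 t2]; have : `|gamma t| <= M by apply: mono; lra.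
  by rewrite ler_norml => /andP[g1 g2]; apply: in_rectangle => /=; lra.
have LE : L * L = d `^ (- 2) by rewrite /L -invfM -expr2 powRN powR_mulrn// ltW.
rewrite LE powRM ?powR_ge0// -!powRrM in H.
have dy : 0 < d `^ (2 * y) by rewrite powR_gt0.
have -> : 2 * (x - y) = 2 * x + - 2 * y by ring.
rewrite powRD ?(gt_eqF dpos) ?implybT//.
have E : d `^ (- 2 * x) = (d `^ (2 * x))^-1 by rewrite -powRN mulNr.
have dx : 0 < d `^ (2 * x) by rewrite powR_gt0.
rewrite E mulrA ler_pdivlMr// in H.
by rewrite mulrC; lra.
Qed.

(* A ball of radius [d] has averages of size [d] on the [d]-neighbourhood of
   the curve. *)
Lemma knapp_ball (R : realType) (gamma : R -> R) (x y C L : R) :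
  derivable_in `]0, 1]%classic gamma -> 1 <= L ->
  (forall s t, 2^-1 <= s <= 1 -> 2^-1 <= t <= 1 ->
    `|gamma s - gamma t| <= L * `|s - t|) ->
  knapp_bound gamma x y C -> 0 <= C -> 2 * x - 1 <= y.
Proof.
move=> D1 L1 Lip HC C0; have L0 : 0 < L by lra.
rewrite -subr_ge0.
have -> : y - (2 * x - 1) = 1 + y - 2 * x by ring.
apply: (@power_bounded_near0 _ 1 _ (4 * L * C * 4 `^ x * 4 `^ y)) => // d d0 d1.
pose gam := gamma \_ `]0, 1]%classic.
have mgam : measurable_fun setT gam by exact: measurable_patch_gamma.
have dL : d / (4 * L) <= d / 4.
  by rewrite ler_wpM2l ?(ltW d0)// lef_pV2 ?posrE//; lra.
have h0 : 0 <= d / (4 * L) by rewrite divr_ge0 ?(ltW d0)// mulr_ge0// ltW.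
have Lh : L * (d / (4 * L)) = d / 4 by field; rewrite gt_eqF.
(* In a time window of length d / (4 L) the curve rises by at most d / 4; with the half-width d / 2
   of the strip this stays below d. Stopping the strip at 3 / 4 leaves room for the window inside
   ]0, 1]. *)
have := HC (rectangle (- d) d (- d) d) (strip gam 2^-1 (3 / 4) (d / 2))
  (4 * (d * d)) (d / 4) (d / (4 * L)) (measurable_rectangle _ _ _ _)
  (measurable_strip _ _ _ mgam).
rewrite lebesgue2_rectangle ?lebesgue2_strip//; [|lra|lra|lra|lra].
move=> H.
have {}H : d / (4 * L) * (d / 4) `^ y <= C * (4 * (d * d)) `^ x.
  apply: H; rewrite ?lee_fin//.
  - by rewrite !mulr_ge0 ?(ltW d0).
  - by rewrite divr_gt0.
  - lra.
  - lra.
  move=> z /andP[/andP[z1 z2]]; rewrite ler_norml => /andP[z3 z4].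
  exists z.1; first by split; lra.
  move=> t /andP[t1 t2].
  have gE : gam z.1 = gamma z.1.
    by rewrite /gam patchE mem_set//= in_itv/=; apply/andP; split; lra.
  have z12 : 2^-1 <= z.1 <= 1 by apply/andP; split; lra.
  have t12 : 2^-1 <= t <= 1 by apply/andP; split; lra.
  have : `|gamma z.1 - gamma t| <= d / 4.
    apply: le_trans (Lip _ _ z12 t12) _; rewrite -Lh ler_wpM2l ?(ltW L0)//.
    by rewrite distrC ger0_norm; lra.
  by rewrite ler_norml -gE => /andP[g1 g2]; apply: in_rectangle => /=; lra.
have dx : 0 < d `^ (2 * x) by rewrite powR_gt0.
have dd : d * d = d `^ 2 by rewrite powR_mulrn ?expr2// ltW.
rewrite powRD ?(gt_eqF d0) ?implybT// powRD ?(gt_eqF d0) ?implybT// powRr1 ?(ltW d0)//.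
rewrite powRN ler_pdivrMr//.
move: H; rewrite dd (powRM x) ?powR_ge0// -powRrM (powRM y) ?(ltW d0) ?invr_ge0//.
have E4 : 4^-1 `^ y = (4 `^ y)^-1 :> R.
  by rewrite -powR_inv1// -powRrM mulN1r powRN.
have y40 : 0 < (4 : R) `^ y by rewrite powR_gt0.
rewrite E4 => H.
have e4 : (4 * L * 4 `^ y) * (d / (4 * L) * (d `^ y / 4 `^ y)) = d * d `^ y.
  by field; rewrite !gt_eqF.
rewrite -e4 (_ : 4 * L * C * 4 `^ x * 4 `^ y * d `^ (2 * x) =
  4 * L * 4 `^ y * (C * (4 `^ x * d `^ (2 * x)))); last by ring.
by rewrite ler_wpM2l// !mulr_ge0 ?ltW.
Qed.

(* Dually, the [d]-neighbourhood of the reflected curve has averages of size 1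
   on a ball of radius [d]. *)
Lemma knapp_neighbourhood (R : realType) (gamma : R -> R) (x y C L : R) :
  derivable_in `]0, 1]%classic gamma -> 1 <= L ->
  (forall s t, 2^-1 <= s <= 1 -> 2^-1 <= t <= 1 ->
    `|gamma s - gamma t| <= L * `|s - t|) ->
  knapp_bound gamma x y C -> 0 <= C -> x / 2 <= y.
Proof.
move=> D1 L1 Lip HC C0; have L0 : 0 < L by lra.
suff : 0 <= 2 * y - x by lra.
apply: (@power_bounded_near0 _ 4^-1 _ (4 * C * (1 + L) `^ x)); first by rewrite invr_gt0.
move=> d d0 d1.
pose gam := gamma \_ `]0, 1]%classic.
have mgam : measurable_fun setT gam by exact: measurable_patch_gamma.
(* The curve reflected through the origin; differences, rather than opposites, are a form that
   [meas] handles. *)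
pose phi (w : R) := 0 - gam (0 - w).
have mphi : measurable_fun setT phi by rewrite /phi; meas.
have := HC (strip phi (-1) (- 2^-1) ((1 + L) * d)) (rectangle 0 d 0 d)
  ((1 + L) * d) (d * d) 4^-1
  (measurable_strip _ _ _ mphi) (measurable_rectangle _ _ _ _).
have Ld : 0 <= (1 + L) * d by rewrite mulr_ge0 ?(ltW d0)//; lra.
rewrite lebesgue2_rectangle ?(ltW d0)// lebesgue2_strip//; last by lra.
rewrite !subr0 => H.
have {}H : 4^-1 * (d * d) `^ y <= C * ((1 + L) * d) `^ x.
  apply: H => //; rewrite ?lee_fin ?mulr_gt0 ?invr_ge0//; first by lra.
  (* The window is [3/4, 1], and d <= 1/4 keeps t - z.1 in [1/2, 1], where gamma is Lipschitz. The
     vertical error is at most d from z.2 and L d from gamma. *)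
  move=> z /rectangle_in[/andP[z1 z2] /andP[z3 z4]]; exists (3 / 4); first by split; lra.
  move=> t /andP[t1 t2].
  have tz : 2^-1 <= t - z.1 <= 1 by apply/andP; split; lra.
  have t12 : 2^-1 <= t <= 1 by apply/andP; split; lra.
  have gE : phi (z.1 - t) = - gamma (t - z.1).
    rewrite /phi !sub0r opprB; congr (- _).
    by rewrite /gam patchE mem_set//= in_itv/=; move: tz => /andP[u1 u2]; apply/andP; split; lra.
  rewrite /strip /= gE; apply/andP; split; first by apply/andP; split; lra.
  have : `|gamma t - gamma (t - z.1)| <= L * d.
    apply: le_trans (Lip _ _ t12 tz) _; rewrite ler_wpM2l ?(ltW L0)//.
    by rewrite subKr ger0_norm.
  by rewrite !ler_norml => /andP[g1 g2]; apply/andP; split; lra.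
have dx : 0 < d `^ x by rewrite powR_gt0.
have dd : d * d = d `^ 2 by rewrite powR_mulrn ?expr2// ltW.
rewrite powRD ?(gt_eqF d0) ?implybT// powRN ler_pdivrMr//.
have L10 : 0 <= 1 + L by lra.
move: H; rewrite dd -powRrM powRM ?(ltW d0)//; lra.
Qed.

(* Test on a [t] by [`|gamma t|] box at the origin: averages have size [t] on a
   comparable box. *)
Lemma knapp_origin (R : realType) (gamma : R -> R) (x y C : R) :
  (forall s t, 0 < s -> s <= t -> t <= 1 -> `|gamma s| <= `|gamma t|) ->
  knapp_bound gamma x y C -> 0 <= C ->
  forall t, 0 < t -> t <= 1 -> 0 < `|gamma t| ->
  t * (t * `|gamma t|) `^ (y - x) <= 2 * C * 8 `^ x * 2 `^ (- y).
Proof.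
move=> mono HC C0 t t0 t1; set G := `|gamma t| => g0.
(* On the window [t/2, t] monotonicity gives |gamma| <= G, so points of the smaller box are moved
   within the larger one. *)
have := HC (rectangle (- t) t (- (2 * G)) (2 * G)) (rectangle 0 t (- G) G)
  (8 * (t * G)) (2 * (t * G)) (t / 2)
  (measurable_rectangle _ _ _ _) (measurable_rectangle _ _ _ _).
have tG : 0 < t * G by rewrite mulr_gt0.
rewrite !lebesgue2_rectangle; [|lra|lra|lra|lra].
rewrite !lee_fin => H.
have {}H : t / 2 * (2 * (t * G)) `^ y <= C * (8 * (t * G)) `^ x.
  apply: H; [by rewrite mulr_ge0// ltW|by rewrite mulr_gt0|lra|lra|lra|].
  move=> z /rectangle_in[/andP[z1 z2] /andP[z3 z4]]; exists (t / 2); first by split; lra.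
  move=> s /andP[s1 s2]; have : `|gamma s| <= G by apply: mono; lra.
  by rewrite ler_norml => /andP[g1 g2]; apply: in_rectangle => /=; lra.
have tGx : 0 < (t * G) `^ x by rewrite powR_gt0.
have t2y : 0 < (2 : R) `^ y by rewrite powR_gt0.
rewrite powRD ?(gt_eqF tG) ?implybT// !powRN mulrA ler_pdivrMr//.
rewrite mulrAC ler_pdivlMr//.
by move: H; rewrite !powRM ?(ltW tG)//; lra.
Qed.

Lemma lt_omega_frequently (R : realType) (gamma : R -> R) (w d0 : R) :
  (forall t, t \in `]0, 1]%classic -> gamma t != 0) ->
  (w%:E < omega gamma)%E -> 0 < d0 ->
  exists2 t, 0 < t <= d0 & t < 1 /\ `|gamma t| <= t `^ w.
Proof.
(* The cap 1/2 keeps ln t negative, so that the inequality between quotients can be turned into one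
   for |gamma t|. *)
move=> gN0 wom d00; pose d1 := Num.min d0 2^-1.
have d10 : 0 < d1 by rewrite lt_min d00/= invr_gt0 ltr0n.
pose V : set R := [set t | 0 < t < d1].
have V0 : (0 : R)^'+ V.
  near=> t; rewrite /V/=; apply/andP; split; first by near: t; exact: nbhs_right_gt.
  by near: t; exact: nbhs_right_lt.
have : (omega gamma <= ereal_sup [set (ln `|gamma t| / ln t)%:E | t in V])%E.
  by apply: ereal_inf_lbound; exists V.
move=> /(lt_le_trans wom) /ereal_sup_gt[_ [t /andP[t0 td] <-]]; rewrite lte_fin => wt.
have td0 : t <= d0 by rewrite (le_trans (ltW td))// ge_min lexx.
have t1 : t < 1.
  by apply: lt_le_trans td _; rewrite ge_min; apply/orP; right; rewrite invf_le1// ler1n.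
exists t; first by rewrite t0.
split=> //; have lnt : ln t < 0 by rewrite ln_lt0// t0.
have g0 : 0 < `|gamma t| by rewrite normr_gt0 gN0// inE/= in_itv/= t0 ltW.
rewrite ltr_ndivlMr// in wt.
by rewrite /powR gt_eqF// -[leLHS]lnK ?posrE// ler_expR ltW.
Unshelve. all: by end_near. Qed.

(** For each real w < omega there are arbitrarily small t with |gamma t| <= t ^ w; as r <= 0, the
    test inequality then bounds t ^ (1 + (1 + w) r), so this exponent is nonnegative. It remains to
    let w approach omega. *)
Lemma omega_necessary (R : realType) (gamma : R -> R) (r A : R) :
  (forall t, t \in `]0, 1]%classic -> gamma t != 0) -> r <= 0 ->
  (forall t, 0 < t -> t <= 1 -> 0 < `|gamma t| -> t * (t * `|gamma t|) `^ r <= A) ->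
  (0 <= 1 + (1 + omega gamma) * r%:E)%E.
Proof.
move=> gN0; rewrite le_eqVlt => /predU1P[->|r0] HA; first by rewrite mule0 adde0 lee01.
have key w : (w%:E < omega gamma)%E -> 0 <= 1 + (1 + w) * r.
  move=> wom; apply: (@power_bounded_frequently _ _ A) => d0 d00.
  have [t /andP[t0 td] [t1 gt]] := lt_omega_frequently gN0 wom d00.
  exists t; first by rewrite t0.
  have g0 : 0 < `|gamma t| by rewrite normr_gt0 gN0// inE/= in_itv/= t0 ltW.
  apply: le_trans (HA t t0 (ltW t1) g0).
  rewrite powRD ?(gt_eqF t0) ?implybT// powRr1 ?(ltW t0)// ler_wpM2l ?(ltW t0)//.
  rewrite powRrM powRD ?(gt_eqF t0) ?implybT// powRr1 ?(ltW t0)//.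
  rewrite -[r]opprK !(powRN _ (- r)) lef_pV2 ?posrE ?powR_gt0 ?mulr_gt0 ?powR_gt0//.
  rewrite ge0_ler_powR ?nnegrE ?mulr_ge0 ?powR_ge0 ?(ltW t0)//.
    by rewrite oppr_ge0 ltW.
  by rewrite ler_wpM2l// ltW.
case: (omega gamma) key => [om| |] key.
- rewrite [leRHS](_ : _ = (1 + (1 + om) * r)%:E)// lee_fin leNgt; apply/negP => neg.
  (* If the quantity at [om] were negative, this w would lie below [om] and the quantity at w would
     be half of it, still negative. *)
  have := key (om - (1 + (1 + om) * r) / (2 * r)); clear key.
  have -> : 1 + (1 + (om - (1 + (1 + om) * r) / (2 * r))) * r = (1 + (1 + om) * r) / 2.
    by field; rewrite lt_eqF.
  have r2 : 2 * r < 0 by rewrite pmulr_rlt0.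
  rewrite lte_fin ltrBlDr ltrDl ltr_ndivlMr// mul0r => /(_ neg).
  by rewrite leNgt pmulr_llt0// neg.
(* An infinite omega admits every w; this one gives r - 1 < 0, a contradiction. *)
- have := key (- 2 / r) (ltry _).
  have -> : 1 + (1 + - 2 / r) * r = r - 1 by field; rewrite lt_eqF.
  by rewrite subr_ge0 leNgt (lt_trans r0).
- by rewrite addeNy lt0_mulNye ?lte_fin// addey// leey.
Qed.

Theorem theorem2p1 (R : realType) (gamma : R -> R)
  (gamma_C2 : Cn_in `]0, 1] 2 gamma)
  (gamma_mono : monotonic_in `]0, 1] gamma)
  (gamma_lim0 : gamma t @[t --> 0^'+] --> 0)
  (gamma_neq0 : forall t, t \in `]0, 1] -> gamma t != 0)
  (gamma_lower : forall j : nat, (1 <= j <= 2)%N ->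
     exists2 C : R, 0 < C & forall t, t \in `]0, 1] ->
       C <= `|t ^+ j * deriven_in `]0, 1] j gamma t / gamma t|)
  (gamma_upper : exists2 C : R, 0 < C & forall t, t \in `]0, 1] ->
       `|t * derive_in `]0, 1] gamma t / gamma t| <= C)
  (p q : \bar R) (p_ge1 : (1 <= p)%E) (q_ge1 : (1 <= q)%E) :
  (triangle (recip p, recip q) ->
   (0 < 1 + (1 + omega gamma) * (recip q - recip p)%:E)%E ->
   uniform_Lp_Lq gamma p q) /\
  (uniform_Lp_Lq gamma p q ->
   triangle (recip p, recip q) /\
   (0 <= 1 + (1 + omega gamma) * (recip q - recip p)%:E)%E).
Proof.
(* The hypotheses speak of membership in the interval, the lemmas of membership in the corresponding
   set. *)
have itvD (t : R) : t \in (`]0, 1]%classic : set R) -> t \in `]0, 1] by rewrite inE.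
have D1 : derivable_in `]0, 1]%classic gamma by case: gamma_C2 => H _; exact: (H 0%N).
have gN0 t : t \in (`]0, 1]%classic : set R) -> gamma t != 0.
  by move=> /itvD; exact: gamma_neq0.
have [c c0 gc] : exists2 c : R, 0 < c & curvature_lower gamma c.
  apply: gamma_curvature => //; have [//|C C0 HC] := gamma_lower 2%N.
  by exists C => // t /itvD; exact: HC.
split; first exact: (sufficiency D1 c0 gc gamma_mono gamma_lim0 gN0 p_ge1 q_ge1).
move=> unif.
have mono s t := @monotonic_abs_le _ _ gamma_mono gamma_lim0 s t.
have [C /ltW C0 HC] := knapp_test D1 p_ge1 q_ge1 unif.
have [L L1 Lip] : exists2 L : R, 1 <= L &
    forall s t, 2^-1 <= s <= 1 -> 2^-1 <= t <= 1 ->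
    `|gamma s - gamma t| <= L * `|s - t|.
  apply: gamma_lipschitz => //; have [C' C'0 HC1] := gamma_upper.
  by exists C' => // t /itvD; exact: HC1.
(* This inequality serves twice: as a side of the triangle, and as the sign condition r <= 0 in
   [omega_necessary]. *)
have yx := knapp_large mono HC C0.
split.
  split=> //=; first exact: knapp_neighbourhood D1 L1 Lip HC C0.
  exact: knapp_ball D1 L1 Lip HC C0.
apply: omega_necessary gN0 _ (knapp_origin mono HC C0).
by rewrite subr_le0.
Qed.
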